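(* Let $X$ be a complete CAT(0) space. Then for any integer $L\ge0$ there is an $\mathrm{Isom}(X)$-equivariant map $\partial_L:\partial_{\mathrm{Grom}}X_L\to\partial_\infty X$ from the Gromov boundary of $X_L=(X,d_L)$ to the visual boundary of $X$ which is a homeomorphic embedding (a homeomorphism onto its image).
   Context: $X$ is not assumed proper. $\partial_\infty X$ is the visual boundary with the cone topology. Curtains. Let $I$ be a closed interval, $\gamma:I\to X$ a geodesic, $\pi_\gamma$ the closest-point projection onto $\gamma(I)$, and $t\in I$ with $[t-\frac12,t+\frac12]\subseteq I$. The curtain dual to $\gamma$ at $t$ is $h=\pi_\gamma^{-1}(\gamma([t-\frac12,t+\frac12]))$; its halfspaces are $h^-=\pi_\gamma^{-1}(\gamma((-\infty,t-\frac12)\cap I))$ and $h^+=\pi_\gamma^{-1}(\gamma((t+\frac12,\infty)\cap I))$. $h$ separates $A$ from $B$ if $A$ and $B$ lie in different halfspaces of $h$. A chain is a family of curtains $\{h_i\}$ such that $h_i$ separates $h_{i-1}$ from $h_{i+1}$ for every $i$; it separates $A$ from $B$ if each of its curtains does. A chain meets a curtain $h$ if each of its curtains intersects $h$. Two disjoint curtains are $L$-separated if every chain meeting both has cardinality at most $L$. An $L$-chain is a chain of pairwise $L$-separated curtains. Define $d_L(x,x)=0$ and, for $x\ne y$, $d_L(x,y)=1+\max\{|c|: c \text{ is an } L\text{-chain separating } x \text{ from } y\}$. It is known that $d_L$ is a metric, that $X_L=(X,d_L)$ is Gromov-hyperbolic and almost geodesic, and that $\mathrm{Isom}(X)$ acts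 on it by isometries. Gromov boundary. $(x|y)_o=\frac12(d_L(x,o)+d_L(y,o)-d_L(x,y))$. $\partial_{\mathrm{Grom}}X_L$ is the set of classes of sequences with $(x_i|x_j)_o\to\infty$, where $(x_i)\sim(y_i)$ iff $(x_i|y_i)_o\to\infty$; the product extends by $(\xi|\eta)_o=\sup\liminf_i(x_i|y_i)_o$ over $(x_i)\in\xi$, $(y_i)\in\eta$, and the topology is given by the sets $\{\eta:(\xi|\eta)_o>R\}$. *)

(* Defs.v *)
From HB Require Import structures.
From mathcomp Require Import all_boot all_order all_algebra.
From mathcomp Require Import all_classical all_reals all_analysis.

Set Implicit Arguments.
Unset Strict Implicit.
Unset Printing Implicit Defensive.

Import Order.TTheory GRing.Theory Num.Theory.
Import numFieldNormedType.Exports.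

Local Open Scope classical_set_scope.
Local Open Scope ring_scope.

Section CAT0.
Context {R : realType} (X : metricType R).

Definition complete_space : Prop :=
  forall F : set_system X, ProperFilter F -> cauchy F -> exists x : X, F --> x.

(* Paths are total functions on R; only their values on [I] matter. *)
Definition geodesic_on (I : set R) (c : R -> X) : Prop :=
  forall s t, I s -> I t -> mdist (c s) (c t) = `|s - t|.

Definition geodesic_segment (x y : X) (c : R -> X) : Prop :=
  [/\ c 0 = x, c (mdist x y) = y & geodesic_on `[0, mdist x y] c].

Definition geodesic_space : Prop := forall x y, exists c, geodesic_segment x y c.

(* Euclidean distance: the library's norm on R * R is the sup norm. *)
Definition plane_dist (p q : R * R) : R :=
  Num.sqrt ((p.1 - q.1) ^+ 2 + (p.2 - q.2) ^+ 2).

(* [p'] is the point of the planar segment [a, b] corresponding to the point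
   [p] of a geodesic from [x] to [y], where |ab| = d(x, y). *)
Definition comparison_point (x y p : X) (a b p' : R * R) : Prop :=
  plane_dist a p' = mdist x p /\ plane_dist p' b = mdist p y.

(* Comparison inequality for every geodesic triangle.  Two points on different
   sides always lie on sides sharing a vertex, named [x] here; for two points
   on the same side the inequality is an equality. *)
Definition comparison_inequality : Prop :=
  forall (x y z : X) (c1 c2 c3 : R -> X),
    geodesic_segment x y c1 -> geodesic_segment x z c2 ->
    geodesic_segment y z c3 ->
  forall a b c : R * R,
    plane_dist a b = mdist x y -> plane_dist a c = mdist x z ->
    plane_dist b c = mdist y z ->
  forall (s t : R) (p' q' : R * R),
    0 <= s <= mdist x y -> 0 <= t <= mdist x z ->
    comparison_point x y (c1 s) a b p' -> comparison_point x z (c2 t) a c q' ->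
    mdist (c1 s) (c2 t) <= plane_dist p' q'.

Definition CAT0 : Prop := geodesic_space /\ comparison_inequality.

Definition isometry (g : X -> X) : Prop :=
  bijective g /\ forall x y, mdist (g x) (g y) = mdist x y.

End CAT0.

Section Curtains.
Context {R : realType} (X : metricType R).

Record curtain := Curtain {
  curtain_dom : set R;
  curtain_geo : R -> X;
  curtain_pos : R;
  curtain_dom_interval : is_interval curtain_dom;
  curtain_dom_closed : closed curtain_dom;
  curtain_geodesic : geodesic_on curtain_dom curtain_geo;
  curtain_pos_dom :
    `[curtain_pos - 2^-1, curtain_pos + 2^-1] `<=` curtain_dom }.

(* The preimage of [c (J `&` I)] under the closest-point projection onto
   [c I]. *)
Definition proj_preimage (I : set R) (c : R -> X) (J : set R) : set X :=
  [set x | exists s, [/\ J s, I s &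
    forall r, I r -> mdist x (c s) <= mdist x (c r)]].

Definition curtain_set (h : curtain) : set X :=
  proj_preimage (curtain_dom h) (curtain_geo h)
    `[curtain_pos h - 2^-1, curtain_pos h + 2^-1].

Definition halfspace_minus (h : curtain) : set X :=
  proj_preimage (curtain_dom h) (curtain_geo h) `]-oo, curtain_pos h - 2^-1[.

Definition halfspace_plus (h : curtain) : set X :=
  proj_preimage (curtain_dom h) (curtain_geo h) `]curtain_pos h + 2^-1, +oo[.

Definition separates (h : curtain) (A B : set X) : Prop :=
  (A `<=` halfspace_minus h /\ B `<=` halfspace_plus h) \/
  (A `<=` halfspace_plus h /\ B `<=` halfspace_minus h).

(* A chain of cardinality [n].  Curtains are compared as subsets of [X]: the
   same subset may be dual to several geodesics.  Finite chains suffice, as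
   consecutive members of an infinite chain form finite chains of any size. *)
Definition chain n (c : 'I_n -> curtain) : Prop :=
  injective (fun i => curtain_set (c i)) /\
  forall i j k : 'I_n, j = i.+1 :> nat -> k = j.+1 :> nat ->
    separates (c j) (curtain_set (c i)) (curtain_set (c k)).

Definition chain_separates n (c : 'I_n -> curtain) (A B : set X) : Prop :=
  forall i, separates (c i) A B.

Definition chain_meets n (c : 'I_n -> curtain) (h : curtain) : Prop :=
  forall i, curtain_set (c i) `&` curtain_set h !=set0.

Definition Lseparated (L : nat) (h k : curtain) : Prop :=
  curtain_set h `&` curtain_set k = set0 /\
  forall n (c : 'I_n -> curtain),
    chain c -> chain_meets c h -> chain_meets c k -> (n <= L)%N.

Definition Lchain (L : nat) n (c : 'I_n -> curtain) : Prop :=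
  chain c /\ forall i j : 'I_n, i != j -> Lseparated L (c i) (c j).

Definition Lchain_sizes (L : nat) (x y : X) : set nat :=
  [set n | exists c : 'I_n -> curtain,
     Lchain L c /\ chain_separates c [set x] [set y]].

(* The set is nonempty (n = 0) and, in a CAT(0) space, bounded, so that [sup]
   is a maximum. *)
Definition dL (L : nat) (x y : X) : R :=
  if x == y then 0 else 1 + sup [set n%:R | n in Lchain_sizes L x y].

End Curtains.

(* The quotient of [P] by [E], as the set of its classes. *)
Definition classes (T : Type) (P : set T) (E : T -> T -> Prop) : set (set T) :=
  [set [set v | P v /\ E u v] | u in P].

Section GromovBoundary.
Context {R : realType} (X : metricType R) (L : nat) (o : X).

Definition gromov_product (x y : X) : R :=
  2^-1 * (dL L x o + dL L y o - dL L x y).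

Definition converges_at_infinity (u : nat -> X) : Prop :=
  gromov_product (u ij.1) (u ij.2) @[ij --> (\oo, \oo)] --> +oo.

Definition gromov_equiv (u v : nat -> X) : Prop :=
  gromov_product (u i) (v i) @[i --> \oo] --> +oo.

Definition gromov_boundary : Type :=
  set_type (classes converges_at_infinity gromov_equiv).

HB.instance Definition _ := Choice.on gromov_boundary.

Definition boundary_product (xi eta : gromov_boundary) : \bar R :=
  ereal_sup [set l | exists u v, [/\ val xi u, val eta v &
    l = limn_einf (fun i => (gromov_product (u i) (v i))%:E)]].

(* The sets {eta | (xi | eta) > r} form a neighbourhood basis at xi. *)
Definition gromov_open (U : set gromov_boundary) : Prop :=
  forall xi, U xi ->
    exists r : R, [set eta | (r%:E < boundary_product xi eta)%E] `<=` U.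

Let gromov_openT : gromov_open setT.
Proof. by move=> xi _; exists 0. Qed.

Let gromov_openI : setI_closed gromov_open.
Proof.
move=> U V oU oV xi [/oU[r rU] /oV[s sV]]; exists (Num.max r s) => eta /= h.
split; [apply: rU|apply: sV]; apply: le_lt_trans h;
  by rewrite lee_fin le_max lexx ?orbT.
Qed.

Let gromov_open_bigU (I : Type) (U : I -> set gromov_boundary) :
  (forall i, gromov_open (U i)) -> gromov_open (\bigcup_i U i).
Proof.
move=> oU xi [i _ /oU[r rU]]; exists r => eta /rU Ueta; by exists i.
Qed.

HB.instance Definition _ := isOpenTopological.Build gromov_boundary
  gromov_openT gromov_openI gromov_open_bigU.

End GromovBoundary.

Section VisualBoundary.
Context {R : realType} (X : metricType R).

Definition ray (c : R -> X) : Prop := geodesic_on `[0, +oo[ c.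

Definition asymptotic (c c' : R -> X) : Prop :=
  exists K : R, forall t, 0 <= t -> mdist (c t) (c' t) <= K.

(* The points do not depend on the basepoint [o], which is used for the
   topology. *)
Definition visual_boundary (o : X) : Type := set_type (classes ray asymptotic).

HB.instance Definition _ (o : X) := Choice.on (visual_boundary o).

Context (o : X).

Definition cone_nbhd (xi : visual_boundary o) (r e : R) :
    set (visual_boundary o) :=
  [set eta | exists c c', [/\ val xi c /\ c 0 = o, val eta c' /\ c' 0 = o &
     forall t, 0 <= t <= r -> mdist (c t) (c' t) < e]].

(* Cone topology: uniform convergence on compact sets of the rays issuing
   from [o]. *)
Definition cone_open (U : set (visual_boundary o)) : Prop :=
  forall xi, U xi -> exists r e : R, 0 < e /\ cone_nbhd xi r e `<=` U.

Let cone_openT : cone_open setT.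
Proof. by move=> xi _; exists 0, 1. Qed.

Let cone_openI : setI_closed cone_open.
Proof.
move=> U V oU oV xi [/oU[r [e [e0 rU]]] /oV[s [f [f0 sV]]]].
exists (Num.max r s), (Num.min e f); split; first by rewrite lt_min e0 f0.
move=> eta [c [c' [hc hc' h]]]; split; [apply: rU|apply: sV];
  exists c, c'; split=> // t /andP[t0 tr];
  have /h : 0 <= t <= Num.max r s by rewrite t0 le_max tr ?orbT.
all: by rewrite lt_min => /andP[].
Qed.

Let cone_open_bigU (I : Type) (U : I -> set (visual_boundary o)) :
  (forall i, cone_open (U i)) -> cone_open (\bigcup_i U i).
Proof.
move=> oU xi [i _ /oU[r [e [e0 rU]]]]; exists r, e; split=> // eta /rU h.
by exists i.
Qed.

HB.instance Definition _ := isOpenTopological.Build (visual_boundary o)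
  cone_openT cone_openI cone_open_bigU.

End VisualBoundary.

(* The action on boundary points: [g] maps the class of [u] to the class of
   [g \o u]. *)
Definition push (D T : Type) (g : T -> T) (C : set (D -> T)) : set (D -> T) :=
  [set g \o u | u in C].

(* The translate [eta] of [xi] by [g] is required to exist: its existence is
   part of the assertion that Isom(X) acts on the Gromov boundary. *)
Definition isom_equivariant {R : realType} (X : metricType R) (L : nat) (o : X)
    (f : gromov_boundary L o -> visual_boundary o) : Prop :=
  forall g : X -> X, isometry g -> forall xi, exists2 eta,
    val eta = push g (val xi) & val (f eta) = push g (val (f xi)).

Definition homeomorphic_embedding (S T : topologicalType) (f : S -> T) : Prop :=
  [/\ injective f, continuous f &
      forall U : set S, open U ->
        exists2 V : set T, open V & f @` U = V `&` range f].

(* Main.v *)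
(* A coarse description of the Gromov product drives the proof: (x|y)_o agrees,
   up to a constant depending only on L, with the largest size of an L-chain
   separating o from both x and y.  This, like hyperbolicity, comes from cutting
   and gluing chains, using that few curtains of a chain can meet two L-separated
   curtains.
   If such a chain is long, the geodesics [o,x] and [o,y] are forced through a
   common bottleneck far from o, so by convexity they stay close near o.  Hence
   for a sequence x_i converging to a point of the Gromov boundary the geodesics
   [o,x_i] converge, by completeness, to a ray c, whose class is the image of
   that point.  Conversely geodesics do not backtrack through long L-chains.  So
   if T is large and another such limit ray c', of a sequence y_i, is close to c
   at time T, then a long L-chain separates o from x_i and y_i; this gives
   injectivity and openness.  Isometries permute curtains, which gives
   equivariance. *)

Require Import Defs.
From HB Require Import structures.
From mathcomp Require Import all_boot all_order all_algebra.
From mathcomp Require Import all_classical all_reals all_analysis.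
From mathcomp Require Import ring lra zify.

Set Implicit Arguments.
Unset Strict Implicit.
Unset Printing Implicit Defensive.

Import Order.TTheory GRing.Theory Num.Theory.
Import numFieldNormedType.Exports.

Local Open Scope classical_set_scope.
Local Open Scope ring_scope.

(** * Comparison inequalities *)

(** Curtains need not be convex, so a geodesic may cross one several times; this is why the absence
    of backtracking needs an argument of its own. What replaces convexity is the position of the
    projection, viewed as a real function: it is 1-Lipschitz, and the preimages of intervals under
    it behave as connected sets. Every cutting, gluing and crossing argument rests on these two
    facts. L-separation is turned into metric information by one device. If two L-separated curtains
    both stretch over a geodesic segment, the curtains dual to that segment form a chain meeting
    both, so the segment has length at most L + 1. As [X] need not be proper, limit rays cannot come
    from compactness of bounded sets; they come from fellow travelling estimates that are uniform in
    the endpoints and make the geodesics Cauchy at each time. *)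

Lemma lipschitz_within (R : realType) (A : set R) (f : R -> R) :
  (forall s t, A s -> A t -> `|f s - f t| <= `|s - t|) ->
  {within A, continuous f}.
Proof.
move=> fl; apply/subspace_continuousP => x Ax; apply/cvgrPdist_lt => e e0.
have xe : \forall t \near x, `|x - t| < e by exact: (@nbhsx_ballx _ R^o x e e0).
near=> t; have At : A t by near: t; exact: withinT.
rewrite (le_lt_trans (fl _ _ Ax At))//.
by near: t; exact: (cvg_within A xe).
Unshelve. all: by end_near. Qed.

Lemma lipschitz_IVT (R : realType) (f : R -> R) (a b v : R) :
  a <= b ->
  (forall s t, s \in `[a, b] -> t \in `[a, b] -> `|f s - f t| <= `|s - t|) ->
  Num.min (f a) (f b) <= v <= Num.max (f a) (f b) ->
  exists2 c, c \in `[a, b] & f c = v.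
Proof. by move=> ab fl; apply: IVT => //; apply: lipschitz_within. Qed.

Section Distance.
Context {R : realType} (X : metricType R).
Implicit Types x y z : X.

Lemma mdistC x y : mdist x y = mdist y x.
Proof. exact: metric_sym. Qed.

Lemma mdist_triangle x y z : mdist x z <= mdist x y + mdist y z.
Proof. exact: metric_triangle. Qed.

Definition lip1 (f : X -> R) := forall x y, f x - f y <= mdist x y.

Lemma lip1_norm f x y : lip1 f -> `|f x - f y| <= mdist x y.
Proof.
move=> fl; have := fl x y; have := fl y x; rewrite (mdistC y).
by rewrite ler_norml; lra.
Qed.

Lemma geodesic_onW (I J : set R) (c : R -> X) :
  J `<=` I -> geodesic_on I c -> geodesic_on J c.
Proof. by move=> JI cI s t /JI sI /JI tI; exact: cI. Qed.

Lemma geodesic_IVT f (c : R -> X) a b v : lip1 f -> a <= b ->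
  geodesic_on `[a, b] c ->
  Num.min (f (c a)) (f (c b)) <= v <= Num.max (f (c a)) (f (c b)) ->
  exists2 s, a <= s <= b & f (c s) = v.
Proof.
move=> fl ab cg /(lipschitz_IVT (f := f \o c) ab)[s t sI tI|s sI <-].
  by rewrite -[leRHS]cg//; exact: lip1_norm.
by exists s.
Qed.

End Distance.

Section Cat0.
Context {R : realType} (X : metricType R) (X_CAT0 : CAT0 X).
Implicit Types (x y z p q : X) (a b l s t u v : R).

(** Stewart's formula holds with equality in the comparison triangle; multiplying by [mdist x y]
    avoids a division. *)
Lemma cat0_comparison x y z (c : R -> X) (t : R) :
  geodesic_segment x y c -> 0 <= t <= mdist x y -> 0 < mdist x y ->
  mdist x y * mdist z (c t) ^+ 2 <=
  (mdist x y - t) * mdist x z ^+ 2 + t * mdist y z ^+ 2 -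
  t * (mdist x y - t) * mdist x y.
Proof.
move=> cxy t01 l0; have [geoX cmp] := X_CAT0.
have [c2 c2xz] := geoX x z; have [c3 c3yz] := geoX y z.
have t1 := mdist_triangle x y z; have t2 := mdist_triangle x z y.
have t3 := mdist_triangle y x z; rewrite (mdistC z) (mdistC y x) in t2 t3.
have m0 := mdist_ge0 x z; have n0 := mdist_ge0 y z.
have [c0E clE cg] := cxy.
have dp : mdist x (c t) = t.
  have := cg 0 t; rewrite c0E => ->; rewrite /= ?in_itv/= ?lexx ?(ltW l0)//.
  by rewrite sub0r normrN ger0_norm//; lra.
have dq : mdist (c t) y = mdist x y - t.
  have := cg t (mdist x y); rewrite clE => ->; rewrite /= ?in_itv/= ?lexx ?(ltW l0)//.
  by rewrite distrC ger0_norm//; lra.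
have zE : c2 (mdist x z) = z by case: c2xz.
have dz : mdist x (c2 (mdist x z)) = mdist x z by rewrite zE.
move: (mdist x y) (mdist x z) (mdist y z) l0 t1 t2 t3 m0 n0 t01 dp dq zE dz
  (cmp _ _ _ _ _ _ cxy c2xz c3yz).
move=> l m n l0 t1 t2 t3 m0 n0 t01 dp dq zE dz {}cmp.
(* The comparison triangle has vertices (0, 0), (l, 0) and (u, v); [u] is given by the law of
   cosines, and the triangle inequalities make [m ^+ 2 - u ^+ 2] nonnegative. *)
have [u [ul um]] : exists u, 2 * l * u = l ^+ 2 + m ^+ 2 - n ^+ 2 /\ u ^+ 2 <= m ^+ 2.
  clear -l0 t1 t2 t3 m0 n0; exists ((l ^+ 2 + m ^+ 2 - n ^+ 2) / (2 * l)).
  set u := _ / _; have ul : 2 * l * u = l ^+ 2 + m ^+ 2 - n ^+ 2 by rewrite /u; field; lra.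
  split=> //.
  have h1 : u <= m by rewrite -(ler_pM2l (x := 2 * l)); nra.
  have h2 : - m <= u by rewrite -(ler_pM2l (x := 2 * l)); nra.
  by clear ul; nra.
pose v := Num.sqrt (m ^+ 2 - u ^+ 2).
have vE : v ^+ 2 = m ^+ 2 - u ^+ 2 by rewrite sqr_sqrtr// subr_ge0.
have sq (w e : R) : 0 <= e -> w = e ^+ 2 -> Num.sqrt w = e.
  by move=> e0 ->; rewrite sqrtr_sqr ger0_norm.
have : mdist (c t) (c2 m) <= plane_dist (t, 0) (u, v).
  apply: (cmp (0, 0) (l, 0) (u, v)); rewrite /comparison_point /plane_dist//=.
  - by apply: sq; [exact: ltW|ring].
  - by apply: sq => //; rewrite !sub0r !sqrrN vE; ring.
  - by apply: sq => //; rewrite sub0r sqrrN vE; clear -ul; lra.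
  - by rewrite m0 lexx.
  - by split; apply: sq => //; rewrite ?dp ?dq; clear -t01; [lra|ring|lra|ring].
  - split; first by rewrite dz; apply: sq => //; rewrite !sub0r !sqrrN vE; ring.
    by rewrite zE /= !subrr expr0n addr0 sqrtr0 mdistxx.
rewrite zE mdistC /plane_dist /= sub0r sqrrN vE => dle.
have {}dle : mdist z (c t) ^+ 2 <= (t - u) ^+ 2 + (m ^+ 2 - u ^+ 2).
  rewrite -[leRHS]sqr_sqrtr; first by rewrite ler_sqr ?nnegrE ?mdist_ge0 ?sqrtr_ge0.
  by rewrite addr_ge0 ?sqr_ge0// subr_ge0.
move: (mdist z _) dle => D /(ler_wpM2l (ltW l0)).
by have /= := congr1 ( *%R t) ul; move=> h1 h2; clear -h1 h2; lra.
Qed.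

Lemma CN_inequality z (I : set R) (c : R -> X) a b l :
  geodesic_on I c -> is_interval I -> I a -> I b -> 0 <= l <= 1 ->
  mdist z (c ((1 - l) * a + l * b)) ^+ 2 <=
  (1 - l) * mdist z (c a) ^+ 2 + l * mdist z (c b) ^+ 2 -
  l * (1 - l) * (a - b) ^+ 2.
Proof.
move=> cg iI; wlog ab : a b l / a <= b => [hw|] Ia Ib l01.
  have [/hw|ba] := leP a b; first exact.
  have := hw b a (1 - l) (ltW ba) Ib Ia.
  have -> : (1 - (1 - l)) * b + (1 - l) * a = (1 - l) * a + l * b by ring.
  move=> h; have {}h := h ltac:(lra).
  by apply: (le_trans h); lra.
have [->|nab] := eqVneq a b.
  have -> : (1 - l) * b + l * b = b by ring.
  by lra.
have {nab}ab : a < b by rewrite lt_neqAle nab.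
have Iab s : 0 <= s <= b - a -> I (a + s) by move=> s0; apply: (iI a b) => //; lra.
have dE : mdist (c a) (c b) = b - a by rewrite cg// distrC ger0_norm// subr_ge0 ltW.
pose e t := c (a + t).
have eg : geodesic_segment (c a) (c b) e.
  rewrite /e; split; rewrite ?dE ?addr0//; first by congr c; ring.
  move=> s t; rewrite /= !in_itv/= => s0 t0; rewrite cg; [|exact: Iab|exact: Iab].
  by congr `|_|; ring.
have := cat0_comparison z (t := l * (b - a)) eg; rewrite dE /e.
have -> : a + l * (b - a) = (1 - l) * a + l * b by ring.
rewrite !(mdistC _ z); move: (mdist z _) (mdist z _) (mdist z _) => A B D.
clear -ab l01 => h; rewrite -(ler_pM2l (x := b - a)); last by rewrite subr_gt0.
by apply: (le_trans (h _ _)); nra.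
Qed.

(** Moving a fraction [l] from the nearest point towards [c s] cannot decrease the distance to [z].
    The CN inequality there, divided by [l], gives the claim up to a factor [1 - l], and [l] tends
    to 0. *)
Lemma geodesic_proj_obtuse z (I : set R) (c : R -> X) (p s : R) :
  geodesic_on I c -> is_interval I -> I p -> I s ->
  (forall r, I r -> mdist z (c p) <= mdist z (c r)) ->
  mdist z (c p) ^+ 2 + (s - p) ^+ 2 <= mdist z (c s) ^+ 2.
Proof.
move=> cg iI Ip Is zp.
have h l : 0 < l <= 1 ->
    mdist z (c p) ^+ 2 + (1 - l) * (s - p) ^+ 2 <= mdist z (c s) ^+ 2.
  move=> l01; have l01' : 0 <= l <= 1 by lra.
  have := CN_inequality z cg iI Ip Is l01'.
  have Ir : I ((1 - l) * p + l * s).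
    have [ps|sp] := leP p s; first by apply: (iI p s) => //; nra.
    by apply: (iI s p) => //; nra.
  have := zp _ Ir; rewrite -ler_sqr ?nnegrE ?mdist_ge0// => h1 h2.
  have {h1 h2} := le_trans h1 h2.
  move: (mdist z _) (mdist z _) => A B; clear -l01 => h.
  rewrite -(ler_pM2l (x := l)); lra.
apply/ler_addgt0Pr => e e0.
pose k := (s - p) ^+ 2 + 1; have k0 : 0 < k by rewrite ltr_wpDl// sqr_ge0.
pose l := Num.min 1 (e / k).
have l0 : 0 < l by rewrite lt_min ltr01 divr_gt0.
have l1 : l <= 1 by rewrite ge_min lexx.
have le : l * k <= e by rewrite -ler_pdivlMr// ge_min lexx orbT.
have := h l; rewrite l0 l1 => /(_ isT).
move: (mdist z _) (mdist z _) => A B; move: le; clear -l0; rewrite /k.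
move: (_ ^+ 2) => w h1 h2; lra.
Qed.

(** The CN inequality is used twice: from the point of [c] to the geodesic [e], then from the
    endpoint [e b'] to the geodesic [c]. *)
Lemma geodesic_convex (I J : set R) (c e : R -> X) a b a' b' l :
  geodesic_on I c -> is_interval I -> I a -> I b ->
  geodesic_on J e -> is_interval J -> J a' -> J b' ->
  c a = e a' -> 0 <= l <= 1 ->
  mdist (c ((1 - l) * a + l * b)) (e ((1 - l) * a' + l * b')) <=
  l * mdist (c b) (e b').
Proof.
move=> cg iI Ia Ib eg iJ Ja Jb ce l01.
set x := c (_ + _).
have h1 := CN_inequality x eg iJ Ja Jb l01.
have h2 := CN_inequality (e b') cg iI Ia Ib l01.
have Ix : I ((1 - l) * a + l * b).
  have [ps|sp] := leP a b; first by apply: (iI a b) => //; nra.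
  by apply: (iI b a) => //; nra.
have xa : mdist x (e a') ^+ 2 = l ^+ 2 * (a - b) ^+ 2.
  rewrite -ce /x cg// -normrX ger0_norm ?sqr_ge0//; ring.
have eb : mdist (e b') (c a) ^+ 2 = (a' - b') ^+ 2.
  rewrite ce eg// -normrX ger0_norm ?sqr_ge0//; ring.
rewrite -ler_sqr ?nnegrE ?mulr_ge0 ?mdist_ge0 ?(andP l01).1//.
move: h1 h2; rewrite xa eb -/x (mdistC (e b') x) (mdistC (c b)).
move: (mdist _ _) (mdist _ _) (mdist _ _) => A B D; clear -l01 => h1 h2.
nra.
Qed.

(** CN at the midpoint [m] of [x, q], seen from [p] and from [y]; the path from [p] to [y] through
    [m] bounds the other diagonal. *)
Lemma quadrilateral x p q y :
  mdist p y ^+ 2 + mdist x q ^+ 2 <=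
  mdist x p ^+ 2 + mdist p q ^+ 2 + mdist q y ^+ 2 + mdist y x ^+ 2.
Proof.
have [c [c0 cl cg]] := X_CAT0.1 x q.
have h01 : 0 <= (2^-1 : R) <= 1 by lra.
have i0 : `[0, mdist x q]%classic (0 : R) by rewrite /= in_itv/= lexx mdist_ge0.
have il : `[0, mdist x q]%classic (mdist x q) by rewrite /= in_itv/= lexx mdist_ge0.
have := CN_inequality p cg (@interval_is_interval _ _) i0 il h01.
have := CN_inequality y cg (@interval_is_interval _ _) i0 il h01.
rewrite c0 cl; set m := c _; have := mdist_triangle p m y; have := mdist_ge0 p y.
rewrite (mdistC m) (mdistC x p) (mdistC q y).
move: (mdist p m) (mdist y m) (mdist p x) (mdist y x) (mdist p q) (mdist y q) (mdist p y) (mdist x q).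
move=> A B C D E F G H h4 h3 h2 h1; clear -h1 h2 h3 h4.
have : G ^+ 2 <= (A + B) ^+ 2 by rewrite ler_sqr// nnegrE; lra.
have := sqr_ge0 (A - B).
nra.
Qed.

End Cat0.

(** * Projection to a geodesic *)

Section Projection.
Context {R : realType} (X : metricType R) (X_CAT0 : CAT0 X).
Implicit Types (x y z p q : X) (a b l r s t u v : R).

Definition nearest (I : set R) (c : R -> X) x s :=
  I s /\ forall r, I r -> mdist x (c s) <= mdist x (c r).

(** Recording the parameter of the projection instead of the point makes curtains and halfspaces
    conditions on a real function. *)
Definition gproj (I : set R) (c : R -> X) x : R := xget 0 (nearest I c x).

Section Fixed.
Variables (I : set R) (c : R -> X).
Hypotheses (cg : geodesic_on I c) (iI : is_interval I) (clI : closed I)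
  (I0 : I !=set0).

(** Compactness is that of a bounded piece of the parameter line: beyond [2 * D] from [s0] the
    distance to [x] is at least [D] again. *)
Lemma nearest_exists x : exists s, nearest I c x s.
Proof.
have [s0 Is0] := I0; pose D := mdist x (c s0).
have D0 : 0 <= D by exact: mdist_ge0.
pose J := `[s0 - 2 * D, s0 + 2 * D]%classic `&` I.
have Js0 : J s0 by split=> //=; rewrite in_itv/=; lra.
have cJ : compact J by apply: compact_closedI => //; exact: segment_compact.
have JI s : J s -> I s by case.
have cf : {within J, continuous (fun s => mdist x (c s))}.
  apply: lipschitz_within => s t /JI Is /JI It; rewrite -[leRHS]cg//.
  have := mdist_triangle x (c s) (c t); have := mdist_triangle x (c t) (c s).
  rewrite (mdistC (c t)) ler_norml; lra.
have [s] := compact_EVT_min (ex_intro _ s0 Js0) cJ cf.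
rewrite inE => Js smin; exists s; split; first exact: JI.
move=> r Ir; have [Jr|nJr] := pselect (J r); first by apply: smin; rewrite inE.
have : mdist x (c s) <= D by apply: smin; rewrite inE.
move=> /le_trans; apply; have := mdist_triangle (c r) x (c s0).
rewrite cg// (mdistC _ x) -/D.
have : 2 * D <= `|r - s0|.
  rewrite leNgt; apply/negP => h; apply: nJr; split=> //=.
  by move: h; rewrite ltr_norml in_itv/=; lra.
lra.
Qed.

Lemma gprojP x : nearest I c x (gproj I c x).
Proof.
have [s sP] := nearest_exists x; rewrite /gproj.
by case: xgetP => [t _ //|/(_ s)].
Qed.

Lemma gproj_in x : I (gproj I c x). Proof. by case: (gprojP x). Qed.

Lemma gproj_min x r : I r -> mdist x (c (gproj I c x)) <= mdist x (c r).
Proof. by case: (gprojP x) => _; apply. Qed.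

Lemma gproj_obtuse x s : I s ->
  mdist x (c (gproj I c x)) ^+ 2 + (s - gproj I c x) ^+ 2 <= mdist x (c s) ^+ 2.
Proof.
move=> Is; apply: (geodesic_proj_obtuse X_CAT0 cg iI) => //.
- exact: gproj_in.
- exact: gproj_min.
Qed.

Lemma gproj_unique x s : nearest I c x s -> gproj I c x = s.
Proof.
move=> [Is sP]; have := gproj_obtuse x Is.
have := sP _ (gproj_in x); rewrite -ler_sqr ?nnegrE ?mdist_ge0//.
move=> h1 h2; apply/esym/eqP.
rewrite -subr_eq0 -sqrf_eq0 eq_le sqr_ge0 andbT; lra.
Qed.

Lemma gproj_geodesic s : I s -> gproj I c (c s) = s.
Proof.
by move=> Is; apply: gproj_unique; split=> // r Ir; rewrite mdistxx mdist_ge0.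
Qed.

(** Add the two obtuse-angle inequalities at the projections to the inequality for the quadrilateral
    [x], [c s], [c t], [y]. *)
Lemma gproj_lip1 : lip1 (gproj I c).
Proof.
move=> x y; set s := gproj I c x; set t := gproj I c y.
have := gproj_obtuse x (gproj_in y); have := gproj_obtuse y (gproj_in x).
have := quadrilateral X_CAT0 x (c s) (c t) y.
have -> : mdist (c s) (c t) ^+ 2 = (s - t) ^+ 2.
  by rewrite (cg (gproj_in x) (gproj_in y)) -normrX ger0_norm ?sqr_ge0.
rewrite -/s -/t (mdistC (c s) y) (mdistC (c t) y) (mdistC y x).
have := mdist_ge0 x y.
move: (mdist x (c s)) (mdist x (c t)) (mdist y (c s)) (mdist y (c t)) (mdist x y).
move: s t => s t A B C D E; clear => E0 h1 h2 h3.
have : (s - t) ^+ 2 <= E ^+ 2 by lra.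
rewrite -subr_ge0 subr_sqr => h; rewrite leNgt; apply/negP => h'; nra.
Qed.

Lemma gproj_toward x z :
  mdist x z + mdist z (c (gproj I c x)) = mdist x (c (gproj I c x)) ->
  gproj I c z = gproj I c x.
Proof.
move=> xz; apply: gproj_unique; split; first exact: gproj_in.
move=> r Ir; have := gproj_min x Ir; have := mdist_triangle x z (c r).
by rewrite -xz; lra.
Qed.

(* Walk from [x] to its projection, along [c], and out to [y]. *)
Lemma gproj_connected (f : X -> R) x y v : lip1 f ->
  Num.min (f x) (f y) <= v <= Num.max (f x) (f y) ->
  exists2 z, f z = v &
    Num.min (gproj I c x) (gproj I c y) <= gproj I c z <=
    Num.max (gproj I c x) (gproj I c y).
Proof.
move=> fl; wlog : x y / gproj I c x <= gproj I c y => [hw|xy].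
  case/orP: (le_total (gproj I c x) (gproj I c y)) => /hw; first exact.
  rewrite (minC (f y)) (maxC (f y)) => h /h.
  by rewrite minC maxC.
have leg p : Num.min (f p) (f (c (gproj I c p))) <= v <=
    Num.max (f p) (f (c (gproj I c p))) ->
    exists2 z, f z = v & gproj I c z = gproj I c p.
  move=> pv; have [e [e0 el eg]] := X_CAT0.1 p (c (gproj I c p)).
  have d0 := mdist_ge0 p (c (gproj I c p)).
  have := geodesic_IVT (v := v) fl d0 eg; rewrite e0 el => /(_ pv)[s s01 <-].
  exists (e s) => //; apply: gproj_toward.
  have := eg 0 s; have := eg s (mdist p (c (gproj I c p))).
  rewrite e0 el /= !in_itv/= s01 !lexx d0 => -> // -> //.
  by rewrite sub0r normrN distrC !ger0_norm; lra.
set fp := f (c (gproj I c x)); set fq := f (c (gproj I c y)).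
rewrite (min_l xy) (max_r xy) => v01.
have [vx|nvx] := boolP (Num.min (f x) fp <= v <= Num.max (f x) fp).
  by have [z zv zx] := leg x vx; exists z => //; rewrite zx lexx.
have [vy|nvy] := boolP (Num.min (f y) fq <= v <= Num.max (f y) fq).
  by have [z zv zx] := leg y vy; exists z => //; rewrite zx lexx andbT.
have : Num.min fp fq <= v <= Num.max fp fq.
  move: nvx nvy v01; rewrite !ge_min !le_max.
  case: (leP (f x) v); case: (leP v (f x)); case: (leP fp v); case: (leP v fp);
  case: (leP fq v); case: (leP v fq); case: (leP (f y) v); case: (leP v (f y)) => //=; lra.
have cI : geodesic_on `[gproj I c x, gproj I c y] c.
  apply: geodesic_onW cg => s /=; rewrite in_itv/=.
  by apply: iI; exact: gproj_in.
move=> /(geodesic_IVT fl xy cI)[s sxy <-]; exists (c s) => //.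
by rewrite gproj_geodesic//; apply: (iI (gproj_in x) (gproj_in y)).
Qed.

End Fixed.

End Projection.

(** * Curtains *)

(** Chains will be sequences of walls, and membership in a sequence requires a (classical) boolean
    equality. *)
HB.instance Definition _ (R : realType) (X : metricType R) :=
  gen_eqMixin (curtain X).

Section Walls.
Context {R : realType} (X : metricType R).
Implicit Types (x y z : X) (h k : curtain X).

Definition cfun h x : R :=
  gproj (curtain_dom h) (curtain_geo h) x - curtain_pos h.

(* A curtain with a choice of positive side. *)
Definition wall : Type := (bool * curtain X)%type.
HB.instance Definition _ := Equality.on wall.

Implicit Types a b c : wall.

Definition wfun a x : R := if a.1 then - cfun a.2 x else cfun a.2 x.

Definition wflip a : wall := (~~ a.1, a.2).

Lemma wfun_flip a x : wfun (wflip a) x = - wfun a x.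
Proof. by rewrite /wfun /=; case: a.1 => //=; rewrite opprK. Qed.

(* [b] lies on the positive side of [a], and [a] on the negative side of [b]. *)
Definition wlt a b := forall x, wfun a x <= 2^-1 -> wfun b x < - 2^-1.

Lemma wlt_trans a b c : wlt a b -> wlt b c -> wlt a c.
Proof. by move=> ab bc x /ab xb; apply: bc; lra. Qed.

Lemma wltP a b x : wlt a b -> - 2^-1 <= wfun b x -> 2^-1 < wfun a x.
Proof. by move=> ab bx; rewrite ltNge; apply/negP => /ab; lra. Qed.

Lemma wlt_flip a b : wlt a b -> wlt (wflip b) (wflip a).
Proof.
move=> ab x; rewrite !wfun_flip => bx.
have : - 2^-1 <= wfun b x by lra.
by move/(wltP ab); lra.
Qed.

Definition wltL L a b : bool := `[< wlt a b /\ Lseparated L a.2 b.2 >].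

Lemma LseparatedC L h k : Lseparated L h k -> Lseparated L k h.
Proof.
by move=> [hk0 hk]; split=> [|n c cc ck ch]; [rewrite setIC|apply: (hk _ c)].
Qed.

End Walls.

Section Cat0Walls.
Context {R : realType} (X : metricType R) (X_CAT0 : CAT0 X).
Implicit Types (x y z : X) (h k : curtain X) (a b c : wall X).

Lemma curtain_pos_itv h s : - 2^-1 <= s - curtain_pos h <= 2^-1 -> curtain_dom h s.
Proof. by move=> hs; apply: (curtain_pos_dom (c := h)); rewrite /= in_itv/=; lra. Qed.

Lemma curtain_dom0 h : curtain_dom h !=set0.
Proof. by exists (curtain_pos h); apply: curtain_pos_itv; lra. Qed.

Lemma proj_preimageE h (J : set R) x :
  proj_preimage (curtain_dom h) (curtain_geo h) J x <->
  J (gproj (curtain_dom h) (curtain_geo h) x).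
Proof.
have gp := gprojP (@curtain_geodesic _ _ h) (@curtain_dom_closed _ _ h) (@curtain_dom0 h).
have gu := gproj_unique X_CAT0 (@curtain_geodesic _ _ h)
  (@curtain_dom_interval _ _ h) (@curtain_dom_closed _ _ h) (@curtain_dom0 h).
split=> [[s [Js Is sP]]|Jx]; first by rewrite (gu x s).
by have [Ix xP] := gp x; exists (gproj (curtain_dom h) (curtain_geo h) x).
Qed.

Lemma curtain_setE h x : curtain_set h x <-> - 2^-1 <= cfun h x <= 2^-1.
Proof. by rewrite /cfun /curtain_set proj_preimageE /= in_itv/=; lra. Qed.

Lemma curtain_setE' a x : curtain_set a.2 x <-> - 2^-1 <= wfun a x <= 2^-1.
Proof. by rewrite curtain_setE /wfun; case: a.1; lra. Qed.

Lemma halfspace_minusE h x : halfspace_minus h x <-> cfun h x < - 2^-1.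
Proof. by rewrite /cfun /halfspace_minus proj_preimageE /= in_itv/=; lra. Qed.

Lemma halfspace_plusE h x : halfspace_plus h x <-> 2^-1 < cfun h x.
Proof. by rewrite /cfun /halfspace_plus proj_preimageE /= in_itv/=; lra. Qed.

Lemma separatesP h (A B : set X) :
  separates h A B <->
  exists e, (forall x, A x -> wfun (e, h) x < - 2^-1) /\
            (forall x, B x -> 2^-1 < wfun (e, h) x).
Proof.
rewrite /wfun; split=> [[[hA hB]|[hA hB]]|[[] /= [hA hB]]].
- exists false; split=> x; first by move/hA/halfspace_minusE.
  by move/hB/halfspace_plusE.
- exists true; split=> x /=.
    by move/hA/halfspace_plusE; lra.
  by move/hB/halfspace_minusE; lra.
- right; split=> x.
    by move/hA => ?; apply/halfspace_plusE; lra.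
  by move/hB => ?; apply/halfspace_minusE; lra.
- by left; split=> x => [/hA/halfspace_minusE|/hB/halfspace_plusE].
Qed.

Lemma wfun_lip1 a : lip1 (wfun a).
Proof.
have l := gproj_lip1 X_CAT0 (@curtain_geodesic _ _ a.2)
  (@curtain_dom_interval _ _ a.2) (@curtain_dom_closed _ _ a.2) (@curtain_dom0 a.2).
move=> x y; have := l x y; have := l y x; rewrite (mdistC y) /wfun /cfun.
by case: a.1; lra.
Qed.

(** This is the substitute for connectedness of curtains and halfspaces: [f] takes its intermediate
    values without [wfun a] leaving the range between its values at [x] and [y]. The bounds are
    quantified over [u] to avoid minima and maxima. *)
Lemma wfun_connected a (f : X -> R) x y v : lip1 f -> f x <= v <= f y ->
  exists z, [/\ f z = v,
    forall u, wfun a x <= u -> wfun a y <= u -> wfun a z <= u &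
    forall u, u <= wfun a x -> u <= wfun a y -> u <= wfun a z].
Proof.
move=> fl fv.
have := gproj_connected X_CAT0 (@curtain_geodesic _ _ a.2)
  (@curtain_dom_interval _ _ a.2) (@curtain_dom_closed _ _ a.2) (@curtain_dom0 a.2)
  (x := x) (y := y) (v := v) fl.
rewrite !ge_min !le_max (andP fv).1 (andP fv).2 orbT => /(_ isT)[z <-].
rewrite ge_min le_max => /andP[/orP h1 /orP h2].
by exists z; split=> // u; rewrite /wfun /cfun; case: a.1; lra.
Qed.

(** Since [b] is connected and disjoint from [a], it lies on a single side of [a], that of [z0]. A
    point violating the resulting order could be joined to [x] or to [y] within the other side of
    [a], and on the way [b] would be met there. *)
Lemma wlt_total a b x y :
  curtain_set a.2 `&` curtain_set b.2 = set0 ->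
  wfun a x < - 2^-1 -> 2^-1 < wfun a y -> wfun b x < - 2^-1 -> 2^-1 < wfun b y ->
  wlt a b \/ wlt b a.
Proof.
move=> ab0 ax ay bx by_.
have disj z : - 2^-1 <= wfun a z <= 2^-1 -> - 2^-1 <= wfun b z <= 2^-1 -> False.
  move=> /curtain_setE' az /curtain_setE' bz.
  by have : (curtain_set a.2 `&` curtain_set b.2) z by []; rewrite ab0.
have [z0 [bz0 _ _]] : exists z, [/\ wfun b z = 0,
    forall u, wfun a x <= u -> wfun a y <= u -> wfun a z <= u &
    forall u, u <= wfun a x -> u <= wfun a y -> u <= wfun a z].
  by apply: wfun_connected; [exact: wfun_lip1|lra].
have [az0|az0] := ltP 2^-1 (wfun a z0); [left|right].
  have main z : wfun a z <= 2^-1 -> - 2^-1 <= wfun b z <= 2^-1 -> False.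
    move=> az bz.
    have [||w [aw h1 h2]] := @wfun_connected b (wfun a) z z0 2^-1.
    - exact: wfun_lip1.
    - lra.
    - apply: (disj w); first lra.
      by rewrite h1 ?h2//; lra.
  move=> z az; rewrite ltNge; apply/negP => bz.
  have [bz'|bz'] := leP (wfun b z) 2^-1; first by apply: (main z) => //; lra.
  have [||w [bw h1 h2]] := @wfun_connected a (wfun b) x z 0.
  - exact: wfun_lip1.
  - lra.
  - apply: (main w); last lra.
    by apply: h1; lra.
have {}az0 : wfun a z0 < - 2^-1.
  by rewrite ltNge; apply/negP => h; apply: (disj z0); lra.
have main z : - 2^-1 <= wfun a z -> - 2^-1 <= wfun b z <= 2^-1 -> False.
  move=> az bz.
  have [||w [aw h1 h2]] := @wfun_connected b (wfun a) z0 z (- 2^-1).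
  - exact: wfun_lip1.
  - lra.
  - apply: (disj w); first lra.
    by rewrite h1 ?h2//; lra.
move=> z bz; rewrite ltNge; apply/negP => az.
have [bz'|bz'] := leP (- 2^-1) (wfun b z); first by apply: (main z) => //; lra.
have [||w [bw h1 h2]] := @wfun_connected a (wfun b) z y 0.
- exact: wfun_lip1.
- lra.
- apply: (main w); last lra.
  by apply: h2; lra.
Qed.

Lemma wlt_disjoint a b : wlt a b -> curtain_set a.2 `&` curtain_set b.2 = set0.
Proof.
move=> ab; rewrite -subset0 => z [/curtain_setE' az /curtain_setE' bz] /=.
have : wfun b z < - 2^-1 by apply: ab; lra.
lra.
Qed.

Lemma curtain_set0P h : curtain_set h !=set0.
Proof.
exists (curtain_geo h (curtain_pos h)); apply/curtain_setE; rewrite /cfun.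
rewrite (gproj_geodesic X_CAT0); last by apply: curtain_pos_itv; lra.
- lra.
- exact: curtain_geodesic.
- exact: curtain_dom_interval.
- exact: curtain_dom_closed.
- exact: curtain_dom0.
Qed.

Lemma chain_ordered n (w : 'I_n -> wall X) :
  (forall i j : 'I_n, (i < j)%N -> wlt (w i) (w j)) -> chain (fun i => (w i).2).
Proof.
move=> wlt_w; split=> [i j /= eij|i j k ji kj].
  have disj a b : wlt a b -> curtain_set a.2 <> curtain_set b.2.
    move=> /wlt_disjoint + e; rewrite e setIid => b0.
    by have := curtain_set0P b.2; rewrite b0 => -[].
  apply/val_inj/eqP; case: ltngtP => // [/wlt_w/disj //|/wlt_w/disj].
  by move=> /(_ (esym eij)).
apply/separatesP; exists (w j).1; rewrite -surjective_pairing; split=> x.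
  move=> /curtain_setE' xi; apply: (wlt_w i j); last lra.
  by rewrite ji.
move=> /curtain_setE' xk; apply: (@wltP _ _ _ (w k)); last lra.
by apply: wlt_w; rewrite kj.
Qed.

Lemma Lseparated_size L h k (s : seq (wall X)) :
  Lseparated L h k -> pairwise (fun a b => `[< wlt a b >]) s ->
  (forall a, a \in s -> curtain_set a.2 `&` curtain_set h !=set0 /\
                        curtain_set a.2 `&` curtain_set k !=set0) ->
  (size s <= L)%N.
Proof.
move=> [_ hk] ps sm; case: s ps sm => // a0 s; set t := a0 :: s => /(pairwiseP a0) ps sm.
apply: (hk _ (fun i : 'I_(size t) => (nth a0 t i).2)).
- apply: chain_ordered => i j ij.
  by apply/asboolP/ps => //; rewrite inE.
- by move=> i; have [] := sm _ (mem_nth a0 (ltn_ord i)).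
- by move=> i; have [] := sm _ (mem_nth a0 (ltn_ord i)).
Qed.

(* A curtain meeting both [a] and [c] also meets [b], which lies between. *)
Lemma Lseparated_between L a b c :
  wlt a b -> wlt b c -> Lseparated L b.2 c.2 -> Lseparated L a.2 c.2.
Proof.
move=> ab bc [_ Lbc]; split; first by apply: wlt_disjoint; exact: wlt_trans bc.
move=> n d cd da dc; apply: (Lbc _ d) => // i.
have [x [/(@curtain_setE' (false, d i)) dx /curtain_setE' ax]] := da i.
have [y [/(@curtain_setE' (false, d i)) dy /curtain_setE' cy]] := dc i.
have bx : wfun b x < - 2^-1 by apply: ab; lra.
have by_ : 2^-1 < wfun b y by apply: (wltP bc); lra.
have [||z [bz h1 h2]] := @wfun_connected (false, d i) (wfun b) x y 0.
- exact: wfun_lip1.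
- lra.
- exists z; split; last by apply/curtain_setE'; lra.
  by apply/(@curtain_setE' (false, d i)); rewrite h1 ?h2//; lra.
Qed.

Lemma wltL_flip L a b : wltL L a b -> wltL L (wflip b) (wflip a).
Proof.
move=> /asboolP[ab Lab]; apply/asboolP; split; first exact: wlt_flip.
exact: LseparatedC.
Qed.

End Cat0Walls.

(** * Chains separating points *)

Section Sepchain.
Context {R : realType} (X : metricType R) (X_CAT0 : CAT0 X) (L : nat).
Implicit Types (x y z o : X) (a b c : wall X) (s t : seq (wall X)) (A B : set X).

(* An L-chain of [n] curtains separating [A] from [B], listed from [A] to [B]
   and oriented towards [B]. *)
Definition sepchain n A B := exists s, [/\ size s = n, pairwise (wltL L) s,
  forall a x, a \in s -> A x -> wfun a x < - 2^-1 &
  forall a x, a \in s -> B x -> 2^-1 < wfun a x].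

Lemma sepchain_subseq m A B s :
  pairwise (wltL L) s -> (m <= size s)%N ->
  (forall a x, a \in s -> A x -> wfun a x < - 2^-1) ->
  (forall a x, a \in s -> B x -> 2^-1 < wfun a x) ->
  sepchain m A B.
Proof.
move=> ps ms sA sB; exists (take m s).
have sub a : a \in take m s -> a \in s by exact: mem_take.
split; first by rewrite size_takel.
- exact: subseq_pairwise (take_subseq _ _) ps.
- by move=> a x /sub; exact: sA.
- by move=> a x /sub; exact: sB.
Qed.

Lemma sepchainW n m A B A' B' : sepchain n A B -> (m <= n)%N ->
  A' `<=` A -> B' `<=` B -> sepchain m A' B'.
Proof.
move=> [s [<- ps sA sB]] mn AA BB; apply: (sepchain_subseq ps mn).
- by move=> a x /sA + /AA; apply.
- by move=> a x /sB + /BB; apply.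
Qed.

Lemma sepchain0 A B : sepchain 0 A B.
Proof. by exists [::]; split. Qed.

Lemma pairwise_rev_rel (T : Type) (r : rel T) (w : seq T) :
  pairwise r (rev w) = pairwise (fun u v => r v u) w.
Proof.
elim: w => //= u w IHw; rewrite rev_cons pairwise_rcons IHw.
by rewrite all_rev.
Qed.

Lemma sepchainC n A B : sepchain n A B -> sepchain n B A.
Proof.
move=> [s [<- ps sA sB]]; exists [seq wflip a | a <- rev s].
split; first by rewrite size_map size_rev.
- rewrite pairwise_map pairwise_rev_rel; apply: sub_pairwise ps.
  by move=> a b; exact: wltL_flip.
- move=> _ x /mapP[a + ->]; rewrite mem_rev wfun_flip => /sB h /h; lra.
- move=> _ x /mapP[a + ->]; rewrite mem_rev wfun_flip => /sA h /h; lra.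
Qed.

Lemma wltLW a b : wltL L a b -> wlt a b.
Proof. by move=> /asboolP[]. Qed.

(* An L-chain separating two points consists of pairwise disjoint curtains,
   which [wlt_total] sorts, so the indexing of the chain is irrelevant. *)
Lemma sepchain_sizes x y n :
  Lchain_sizes L x y n <-> sepchain n [set x] [set y].
Proof.
split=> [[c [[[cinj cc] cL] cxy]]|[s [<- ps sx sy]]].
  have /choice[e he] : forall i, exists e,
      wfun (e, c i) x < - 2^-1 /\ 2^-1 < wfun (e, c i) y.
    move=> i; have /(separatesP X_CAT0)[e [h1 h2]] := cxy i.
    by exists e; split; [exact: h1|exact: h2].
  pose w i : wall X := (e i, c i).
  pose s0 := [seq w i | i <- enum 'I_n].
  (* Sorting wants a total relation, and [wlt] is irreflexive; hence the added equality. *)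
  pose r a b : bool := (a == b) || `[< wlt a b >].
  have rtr : transitive r.
    move=> b a d /orP[/eqP->//|ab] /orP[/eqP<-|bd]; first by rewrite /r ab orbT.
    apply/orP; right; apply/asboolP.
    by apply: wlt_trans (asboolP _ ab) (asboolP _ bd).
  have rtot : {in s0 &, total r}.
    move=> _ _ /mapP[i _ ->] /mapP[j _ ->]; rewrite /r.
    have [->|ij] := eqVneq i j; first by rewrite eqxx.
    have [h1 h2] := he i; have [h3 h4] := he j; have [h5 _] := cL _ _ ij.
    have [h|h] := wlt_total X_CAT0 (a := w i) (b := w j) h5 h1 h2 h3 h4.
      by apply/orP; left; apply/orP; right; apply/asboolP.
    by apply/orP; right; apply/orP; right; apply/asboolP.
  have winj : injective w by move=> i j [_ /(congr1 (@curtain_set _ _))]; exact: cinj.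
  pose s := sort r s0.
  have ss : pairwise r s.
    rewrite -sorted_pairwise//; apply: (sort_sorted_in rtot).
    by apply/allP.
  have us : pairwise [rel a b | a != b] s.
    by rewrite -uniq_pairwise sort_uniq map_inj_uniq// enum_uniq.
  have sw a : a \in s -> exists i, a = w i.
    by rewrite mem_sort => /mapP[i _ ->]; exists i.
  exists s; split.
  - by rewrite size_sort size_map size_enum_ord.
  - have : pairwise [rel a b | r a b && (a != b)] s by rewrite pairwise_relI ss.
    apply: (sub_in_pairwise (P := mem s)); last exact/allP.
    move=> _ _ /sw[i ->] /sw[j ->] /= /andP[/orP[->//|/asboolP wij] ij].
    apply/asboolP; split=> //; apply: cL; apply: contraNN ij => /eqP ->.
    exact: eqxx.
  - by move=> a _ /sw[i ->] ->; have [] := he i.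
  - by move=> a _ /sw[i ->] ->; have [] := he i.
case: s ps sx sy => [|a0 s]; last set t := a0 :: s; move=> ps sx sy.
  (* [X] may have no curtain at all, so no default value is available for an indexing by [nth]. *)
  exists (fun i : 'I_0 => match i with Ordinal _ h => match notF h with end end).
  by split; [split; [split|]|] => -[].
have pt (i j : 'I_(size t)) : (i < j)%N -> wltL L (nth a0 t i) (nth a0 t j).
  by move=> ij; apply: (pairwiseP a0 ps); rewrite ?inE.
exists (fun i : 'I_(size t) => (nth a0 t i).2); split; first split.
- by apply: (chain_ordered X_CAT0) => i j /pt/wltLW.
- move=> i j ij; have : (i != j :> nat) by [].
  rewrite neq_ltn => /orP[/pt/asboolP[]//|/pt/asboolP[_]].
  exact: LseparatedC.
- move=> i; apply/(separatesP X_CAT0); exists (nth a0 t i).1.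
  rewrite -surjective_pairing; split=> z zE.
    by apply: sx zE; exact: mem_nth.
  by apply: sy zE; exact: mem_nth.
Qed.

(** Each curtain has width 1: a geodesic from [x] needs length at least 1 to leave the first
    curtain, and the remaining ones still separate the exit point from [y]. *)
Lemma sepchain_dist n x y : sepchain n [set x] [set y] -> n%:R <= mdist x y.
Proof.
move=> [s [<- + + +]]; elim: s x => [|a s IHs] x; first by rewrite mdist_ge0.
move=> /= /andP[/allP ra ps] sx sy.
have [e [e0 el eg]] := X_CAT0.1 x y.
have ax : wfun a x < - 2^-1 by apply: sx; rewrite ?mem_head.
have ay : 2^-1 < wfun a y by apply: sy; rewrite ?mem_head.
have d0 := mdist_ge0 x y.
have [|r r0 ar] := geodesic_IVT (v := 2^-1) (wfun_lip1 X_CAT0 a) d0 eg.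
  by rewrite e0 el ge_min le_max; lra.
have IH : (size s)%:R <= mdist (e r) y.
  apply: IHs => // b z bs; last by apply: sy; rewrite inE bs orbT.
  by move=> ->; apply: (wltLW (ra b bs)); rewrite ar.
have xr : mdist x (e r) = r.
  have := eg 0 r; rewrite e0 /= !in_itv/= lexx d0 r0 => -> //.
  by rewrite sub0r normrN ger0_norm; lra.
have ry : mdist (e r) y = mdist x y - r.
  have := eg r (mdist x y); rewrite el /= !in_itv/= lexx d0 r0 => -> //.
  by rewrite distrC ger0_norm; lra.
have := wfun_lip1 X_CAT0 a (e r) x; rewrite (mdistC _ x) xr -natr1; lra.
Qed.

Lemma dL_ge x y n : sepchain n [set x] [set y] -> n%:R <= dL L x y.
Proof.
move=> h; rewrite /dL; case: eqP => [<-{y}|_] in h *.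
  by have := sepchain_dist h; rewrite mdistxx.
set S := [set n%:R | n in _].
have : n%:R <= sup S; last by lra.
apply: ub_le_sup; last by exists n => //; exact/sepchain_sizes.
by exists (mdist x y) => _ [m /sepchain_sizes/sepchain_dist mxy <-].
Qed.

(** The sizes are bounded by [mdist x y], so the supremum is attained. An inequality rather than an
    equality covers [x = y], where [dL] is 0. *)
Lemma dL_le x y : exists2 n, sepchain n [set x] [set y] & dL L x y <= n.+1%:R.
Proof.
have ex : exists n, `[< sepchain n [set x] [set y] >].
  by exists 0; apply/asboolP; exact: sepchain0.
have bd n : `[< sepchain n [set x] [set y] >] -> (n <= Num.trunc (mdist x y))%N.
  move=> /asboolP/sepchain_dist nxy.
  by rewrite truncn_ge_nat// mdist_ge0.
case: (ex_maxnP ex bd) => n /asboolP nxy nmax; exists n => //.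
rewrite /dL; case: eqP => // _.
set S := [set n%:R | n in _].
have : sup S <= n%:R; last by rewrite -natr1; lra.
apply: ge_sup; first by exists n%:R, n => //; exact/sepchain_sizes.
move=> _ [m /sepchain_sizes mxy <-]; rewrite ler_nat; apply: nmax.
exact/asboolP.
Qed.

End Sepchain.

(** * Cutting and gluing chains *)

Section Coarse.
Context {R : realType} (X : metricType R) (X_CAT0 : CAT0 X) (L : nat).
Implicit Types (x y z o : X) (a b c : wall X) (s t : seq (wall X)) (A B : set X).

Local Notation sepchain := (sepchain L).

(** The curtain of [b] has points [v] and [w] on both sides of that of [a], and it is connected. *)
Lemma curtains_meet a b v w :
  - 2^-1 <= wfun b v <= 2^-1 -> - 2^-1 <= wfun b w <= 2^-1 ->
  wfun a v <= 2^-1 -> - 2^-1 <= wfun a w ->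
  curtain_set b.2 `&` curtain_set a.2 !=set0.
Proof.
move=> bv bw av aw.
have [av'|av'] := leP (- 2^-1) (wfun a v).
  by exists v; split; apply/(curtain_setE' X_CAT0) => //; rewrite av' av.
have [aw'|aw'] := leP (wfun a w) 2^-1.
  by exists w; split; apply/(curtain_setE' X_CAT0) => //; rewrite aw' aw.
have [||z [az h1 h2]] := @wfun_connected _ _ X_CAT0 b (wfun a) v w 0.
- exact: wfun_lip1.
- lra.
- exists z; split; apply/(curtain_setE' X_CAT0); last by lra.
  by rewrite h1 ?h2//; lra.
Qed.

Lemma pairwise_wltL_wlt s :
  pairwise (wltL L) s -> pairwise (fun a b => `[< wlt a b >]) s.
Proof. by apply: sub_pairwise => a b /wltLW ab; apply/asboolP. Qed.

Lemma not_wlt a b : `[< wlt a b >] = false ->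
  exists z, wfun a z <= 2^-1 /\ - 2^-1 <= wfun b z.
Proof.
move=> /asboolPn /existsNP[z /not_implyP[az bz]]; exists z; split=> //.
by rewrite leNgt; apply/negP.
Qed.

Lemma size_filterC (T : Type) (p : pred T) (w : seq T) :
  (size (seq.filter p w) + size (seq.filter (predC p) w))%N = size w.
Proof. by rewrite !size_filter count_predC. Qed.

(* If [a1] and [a2] are the first curtains of the second chain, a curtain of the
   first chain which is not below [a2] meets both [a1] and [a2]: there are at
   most [L] of these.  What remains of the first chain is L-separated from the
   curtains beyond [a2] because [a2] lies in between. *)
Lemma sepchain_glue m n x y z :
  sepchain n [set x] [set y; z] -> sepchain m [set x; y] [set z] ->
  sepchain (m + n - L - 2) [set x] [set z].
Proof.
move=> hs [t [<- pt tx tz]].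
case: t pt tx tz => [|a1 [|a2 t]] pt tx tz.
- by apply: (sepchainW hs); [move=> /=; lia| |move=> w ->; right].
- by apply: (sepchainW hs); [move=> /=; lia| |move=> w ->; right].
have [s [<- ps sx sz]] := hs.
move: pt => /= /and3P[/andP[a12 _] a2t pt].
have [a1x a1y] : wfun a1 x < - 2^-1 /\ wfun a1 y < - 2^-1.
  by split; apply: tx; rewrite ?mem_head//; [left|right].
pose good b := `[< wlt b a2 >].
have bad : (size (seq.filter (predC good) s) <= L)%N.
  apply: (Lseparated_size X_CAT0 (h := a1.2) (k := a2.2)).
  - by have /asboolP[] := a12.
  - by apply: pairwise_filter; exact: pairwise_wltL_wlt.
  move=> b; rewrite mem_filter => /andP[/= /negbTE/not_wlt[u [bu a2u]] bs].
  have [bx by_ bz] : [/\ wfun b x < - 2^-1, 2^-1 < wfun b y & 2^-1 < wfun b z].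
    by split; [apply: sx|apply: sz|apply: sz] => //; [left|right].
  (* [w] is on [b] and not below [a2], while [v] will be on [b] and below [a1]; so [b] crosses both
     [a1] and [a2]. *)
  have [||w [bw _ h2]] := @wfun_connected _ _ X_CAT0 a2 (wfun b) u z 2^-1.
  - exact: wfun_lip1.
  - lra.
  have a2z : 2^-1 < wfun a2 z by apply: tz; rewrite // inE mem_head orbT.
  have a2w : - 2^-1 <= wfun a2 w by apply: h2; lra.
  have a1w := wltP (wltLW a12) a2w.
  have [||v [bv h1 _]] := @wfun_connected _ _ X_CAT0 a1 (wfun b) x y 0.
  - exact: wfun_lip1.
  - lra.
  have a1v : wfun a1 v <= - 2^-1 by apply: h1; lra.
  have a2v : wfun a2 v < - 2^-1 by apply: (wltLW a12); lra.
  split; apply: (curtains_meet (v := v) (w := w)); lra.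
(* The losses are at most [L] bad curtains of [s], and the two curtains [a1] and [a2]. *)
exists (take (size (a1 :: a2 :: t) + size s - L - 2) (seq.filter good s ++ t)).
split.
- rewrite size_takel// size_cat; have := size_filterC good s; move: bad => /=; lia.
- apply: (subseq_pairwise (take_subseq _ _)); rewrite pairwise_cat pt pairwise_filter// !andbT.
  apply/allrelP => b c; rewrite mem_filter => /andP[/asboolP ba bs] ct.
  have /asboolP[a2c La2c] := allP a2t _ ct.
  apply/asboolP; split; first exact: wlt_trans a2c.
  exact: Lseparated_between La2c.
- move=> a u /mem_take; rewrite mem_cat mem_filter => /orP[/andP[_ /sx]|ht].
    exact.
  by move=> ->; apply: tx; [rewrite !inE ht !orbT|left].
- move=> a u /mem_take; rewrite mem_cat mem_filter => /orP[/andP[_ /sz h] ->|ht].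
    by apply: h; right.
  by apply: tz; rewrite !inE ht !orbT.
Qed.

(** Curtains are sorted by the side on which [y] lies. As they are disjoint, at most one of them
    contains [y], whence the [+ 1]. *)
Lemma sepchain_split n x y z : sepchain n [set x] [set z] ->
  exists k m, [/\ (n <= k + m + 1)%N,
    sepchain k [set x] [set y; z] & sepchain m [set x; y] [set z]].
Proof.
move=> [s [<- ps sx sz]].
pose p a := 2^-1 < wfun a y; pose q a := wfun a y < - 2^-1.
exists (size (seq.filter p s)), (size (seq.filter q (seq.filter (predC p) s))); split.
- have := size_filterC p s; have := size_filterC q (seq.filter (predC p) s).
  suff : (size (seq.filter (predC q) (seq.filter (predC p) s)) <= 1)%N by lia.
  have := pairwise_filter (predC q) (pairwise_filter (predC p) ps).
  case E : (seq.filter _ (seq.filter _ _)) => [|a [|b t]]//= /andP[/andP[/wltLW ab _] _].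
  have : a \in seq.filter (predC q) (seq.filter (predC p) s) by rewrite E mem_head.
  have : b \in seq.filter (predC q) (seq.filter (predC p) s) by rewrite E !inE eqxx orbT.
  rewrite !mem_filter /= /p /q -!leNgt => /and3P[h1 _ _] /and3P[_ h2 _].
  by have := ab _ h2; lra.
- exists (seq.filter p s); split=> //; first exact: pairwise_filter.
    by move=> a u; rewrite mem_filter => /andP[_]; exact: sx.
  by move=> a u; rewrite mem_filter => /andP[pa /sz h] [->//|->]; exact: h.
- exists (seq.filter q (seq.filter (predC p) s)); split=> //.
  + by do 2 apply: pairwise_filter.
  + move=> a u; rewrite !mem_filter => /and3P[qa _ /sx h] [->|->//]; exact: h.
  + move=> a u; rewrite !mem_filter => /and3P[_ _ /sz]; exact.
Qed.

End Coarse.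

(** * Gromov products and hyperbolicity *)

Section GromovProduct.
Context {R : realType} (X : metricType R) (X_CAT0 : CAT0 X) (L : nat).
Implicit Types (x y z o : X).

Local Notation sepchain := (sepchain L).

(** A coarse form suffices: cutting a maximal chain at [y] loses at most one curtain, and [dL_le]
    costs another 1. *)
Lemma dL_coarse_triangle x y z : dL L x z <= dL L x y + dL L y z + 2.
Proof.
have [n /(sepchain_split y)[k [m [nkm hk hm]]] nle] := dL_le X_CAT0 L x z.
have hk' : k%:R <= dL L x y.
  by apply: dL_ge => //; apply: (sepchainW hk) => // w ->; left.
have hm' : m%:R <= dL L y z.
  by apply: dL_ge => //; apply: (sepchainW hm) => // w ->; right.
move: nkm; rewrite -(ler_nat R) !natrD => nkm.
move: nle; rewrite -natr1; lra.
Qed.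

Lemma dLC x y : dL L x y = dL L y x.
Proof.
rewrite /dL eq_sym; case: eqP => // _; congr (1 + sup _).
by congr (image _ _); apply/seteqP; split=> n /= /(sepchain_sizes X_CAT0)
  /sepchainC /(sepchain_sizes X_CAT0).
Qed.

(** Cut a maximal chain between [x] and [y] at [o] and glue each half to the given chain. Each
    gluing loses [L + 2], the cut and [dL_le] lose 1 each, and half of the sum is [L + 3]. *)
Lemma sepchain_gromov_product k o x y : sepchain k [set o] [set x; y] ->
  k%:R - (L + 3)%:R <= gromov_product L o x y.
Proof.
move=> hk; rewrite /gromov_product.
have [n /(sepchain_split o)[i [j [nij hi hj]]] nle] := dL_le X_CAT0 L x y.
have hi' : sepchain i [set o; y] [set x] by exact: sepchainC.
have hj' : sepchain j [set o; x] [set y] by rewrite setUC.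
have hk' : sepchain k [set o] [set y; x] by rewrite setUC.
have dx := dL_ge X_CAT0 (sepchain_glue X_CAT0 hk' hi').
have dy := dL_ge X_CAT0 (sepchain_glue X_CAT0 hk hj').
have : (i + k <= i + k - L - 2 + (L + 2))%N by lia.
have : (j + k <= j + k - L - 2 + (L + 2))%N by lia.
move: nij; rewrite -!(ler_nat R) !natrD => nij h1 h2.
rewrite (dLC x o) (dLC y o).
move: nle; rewrite -natr1; lra.
Qed.

(** Cut the maximal chains from [o] to [x] and to [y] at the other endpoint. The far pieces glue to
    a chain from [y] to [x], so they are compensated by [dL L x y]; what is left is the near pieces
    [i] and [j], and the longer one serves. *)
Lemma gromov_product_sepchain o x y :
  exists2 k, sepchain k [set o] [set x; y] &
    gromov_product L o x y <= k%:R + (L + 3)%:R.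
Proof.
rewrite /gromov_product (dLC x o) (dLC y o).
have [n /(sepchain_split y)[i [p [nip hi hp]]] nle] := dL_le X_CAT0 L o x.
have [m /(sepchain_split x)[j [q [mjq hj hq]]] mle] := dL_le X_CAT0 L o y.
have hq' : sepchain q [set y] [set o; x] by exact: sepchainC.
have hp' : sepchain p [set y; o] [set x] by rewrite setUC.
have := dL_ge X_CAT0 (sepchain_glue X_CAT0 hq' hp'); rewrite (dLC y x) => dxy.
exists (maxn i j).
  by case: (leqP i j) => _ //; rewrite setUC.
have : (p + q <= p + q - L - 2 + (L + 2))%N by lia.
have : (i + j <= maxn i j + maxn i j)%N by lia.
have L0 : 0 <= (L%:R : R) by rewrite ler0n.
move: nip mjq; rewrite -!(ler_nat R) !natrD.
move: nle mle; rewrite -!(natr1 n) -!(natr1 m); lra.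
Qed.

(* Let [g1], [g2] be the last curtains of the first chain.  Either [g1], and with
   it all of the first chain but [g2], also separates [o] from [z], or all but
   at most [L] curtains of the second chain lie below [g2], hence separate [o]
   from [x]. *)
Lemma sepchain_hyperbolic k o x y z :
  sepchain k [set o] [set x; y] -> sepchain k [set o] [set y; z] ->
  sepchain (k - L - 1) [set o] [set x; z].
Proof.
move=> [s [sk ps so sxy]] [t [tk pt to tyz]].
have [k1|k1] := leqP k 1; first by rewrite (_ : (k - L - 1)%N = 0)//; [exact: sepchain0|lia].
case/lastP: s => [|s g2] in ps so sxy sk *; first by move: sk => /=; lia.
case/lastP: s => [|s g1] in ps so sxy sk *; first by move: sk => /=; lia.
move: ps; rewrite pairwise_rcons all_rcons => /andP[/andP[g12 _] ps].
have g1in : g1 \in rcons (rcons s g1) g2 by rewrite mem_rcons inE mem_rcons mem_head orbT.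
have g2in : g2 \in rcons (rcons s g1) g2 by rewrite mem_rcons mem_head.
have [g1z|g1z] := ltP 2^-1 (wfun g1 z).
  apply: (@sepchain_subseq _ _ L _ _ _ (rcons s g1)) => //.
  - by move: sk; rewrite !size_rcons; lia.
  - by move=> a u ua; apply: so; rewrite mem_rcons inE ua orbT.
  - move=> a u ua [->|->].
      by apply: sxy; [rewrite mem_rcons inE ua orbT|left].
    move: ua; rewrite mem_rcons inE => /orP[/eqP->//|ua].
    apply: (@wltP _ _ _ g1); last lra.
    move: ps; rewrite pairwise_rcons => /andP[/allP/(_ _ ua)/wltLW].
    by [].
pose good b := `[< wlt b g2 >].
have bad : (size (seq.filter (predC good) t) <= L)%N.
  apply: (Lseparated_size X_CAT0 (h := g1.2) (k := g2.2)).
  - by have /asboolP[] := g12.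
  - by apply: pairwise_filter; exact: pairwise_wltL_wlt pt.
  move=> b; rewrite mem_filter => /andP[/= /negbTE/not_wlt[u [bu g2u]] bt].
  have [bo by_ bz] : [/\ wfun b o < - 2^-1, 2^-1 < wfun b y & 2^-1 < wfun b z].
    by split; [apply: to|apply: tyz|apply: tyz] => //; [left|right].
  have g2y : 2^-1 < wfun g2 y by apply: sxy => //; right.
  have g1o : wfun g1 o < - 2^-1 by apply: so.
  have [||w [bw _ h2]] := @wfun_connected _ _ X_CAT0 g2 (wfun b) u y 2^-1.
  - exact: wfun_lip1.
  - lra.
  have g2w : - 2^-1 <= wfun g2 w by apply: h2; lra.
  have g1w := wltP (wltLW g12) g2w.
  have [||v [bv h1 _]] := @wfun_connected _ _ X_CAT0 g1 (wfun b) o z 0.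
  - exact: wfun_lip1.
  - lra.
  have g1v : wfun g1 v <= 2^-1 by apply: h1; lra.
  have g2v := wltLW g12 g1v.
  split; apply: (curtains_meet X_CAT0 (v := v) (w := w)); lra.
apply: (@sepchain_subseq _ _ L _ _ _ (seq.filter good t)).
- exact: pairwise_filter.
- by have := size_filterC good t; lia.
- by move=> a u; rewrite mem_filter => /andP[_]; exact: to.
- move=> a u; rewrite mem_filter => /andP[/asboolP ag2 ta] [->|->].
    apply: (wltP ag2).
    have : 2^-1 < wfun g2 x by apply: sxy => //; left.
    lra.
  by apply: tyz => //; right.
Qed.

(** As the last curtain has width 1, [y] cannot have passed below it, so [y] remains beyond all the
    others. *)
Lemma sepchain_near k o x y : sepchain k.+1 [set o] [set x] -> mdist x y <= 1 ->
  sepchain k [set o] [set x; y].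
Proof.
move=> [s [sk ps so sx]] xy.
case/lastP: s => [|s g] in ps so sx sk *; first by [].
move: ps; rewrite pairwise_rcons => /andP[/allP sg ps].
have gx : 2^-1 < wfun g x by apply: sx; rewrite // mem_rcons mem_head.
have gxy := wfun_lip1 X_CAT0 g x y.
exists s; split=> //.
- by move: sk; rewrite size_rcons => -[].
- by move=> a u ua; apply: so; rewrite mem_rcons inE ua orbT.
- move=> a u ua [->|->].
    by apply: sx; rewrite // mem_rcons inE ua orbT.
  by apply: (wltP (wltLW (sg _ ua))); lra.
Qed.

End GromovProduct.

(** * Curtains dual to a segment *)

Section DualChain.
Context {R : realType} (X : metricType R) (X_CAT0 : CAT0 X) (L : nat).
Implicit Types (x y z o p q : X) (u v r : R).

Lemma gproj_segment_nearest (c : R -> X) u v z r :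
  geodesic_on `[u, v] c -> nearest `[u, v] c z r -> gproj `[u, v] c z = r.
Proof.
move=> cg zr; apply: (gproj_unique X_CAT0) => //.
- exact: interval_is_interval.
- exact: itv_closed.
- by case: zr => ? _; exists r.
Qed.

(** By connectedness such an [h] crosses every curtain dual to [c] on [u, v]. *)
Definition meets_ends (c : R -> X) u v (h : curtain X) :=
  exists p q, [/\ curtain_set h p, curtain_set h q,
    gproj `[u, v] c p = u & gproj `[u, v] c q = v].

(* Curtains dual to [c] would form a long chain meeting both [h] and [k]. *)
Lemma Lseparated_dual_length (c : R -> X) u v (h k : curtain X) :
  geodesic_on `[u, v] c -> Lseparated L h k ->
  meets_ends c u v h -> meets_ends c u v k -> v - u <= L.+1%:R.
Proof.
move=> cg [_ hk] mh mk; rewrite leNgt; apply/negP => uv.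
(* Cut [u, v] into [L.+1] pieces of length [w > 1]; each has room for the curtain dual to its
   midpoint [t i]. *)
pose w := (v - u) / L.+1%:R.
have L0 : 0 < (L.+1%:R : R) by rewrite ltr0n.
have w1 : 1 < w by rewrite ltr_pdivlMr// mul1r.
have wL : w * L.+1%:R = v - u by rewrite /w divfK// gt_eqF.
pose t (i : 'I_L.+1) := u + (i%:R + 2^-1) * w.
have ht i : `[t i - 2^-1, t i + 2^-1] `<=` `[u, v].
  move=> s; rewrite /= !in_itv/= /t.
  have : 0 <= (i%:R : R) by rewrite ler0n.
  have : (i%:R : R) + 1 <= L.+1%:R by rewrite natr1 ler_nat.
  nra.
have cl : closed `[u, v] by exact: itv_closed.
pose d i : wall X := (false, Curtain (@interval_is_interval _ `[u, v])
  cl cg (@ht i)).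
have dE i z : wfun (d i) z = gproj `[u, v] c z - t i by [].
have cd : chain (fun i => (d i).2).
  apply: (chain_ordered X_CAT0) => i j ij z; rewrite !dE /t.
  have : (i%:R : R) + 1 <= j%:R by rewrite natr1 ler_nat.
  nra.
have md e : meets_ends c u v e -> chain_meets (fun i => (d i).2) e.
  move=> [p [q [ep eq pu qv]]] i; rewrite setIC.
  apply: (@curtains_meet _ _ X_CAT0 (d i) (false, e) p q).
  - exact/(curtain_setE' X_CAT0 (false, e)).
  - exact/(curtain_setE' X_CAT0 (false, e)).
  - rewrite dE pu /t; have : 0 <= (i%:R : R) by rewrite ler0n.
    nra.
  - rewrite dE qv /t; have : (i%:R : R) + 1 <= L.+1%:R by rewrite natr1 ler_nat.
    nra.
by have := hk _ _ cd (md _ mh) (md _ mk); rewrite ltnn.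
Qed.

End DualChain.

(** * Chains and geodesics *)

Section Geodesics.
Context {R : realType} (X : metricType R) (X_CAT0 : CAT0 X) (L : nat).
Implicit Types (x y z o p q : X) (r s t u v : R).

Local Notation sepchain := (sepchain L).

Lemma geodesic_segmentP x y (c : R -> X) : geodesic_segment x y c ->
  [/\ 0 <= mdist x y,
      forall s, 0 <= s <= mdist x y -> mdist x (c s) = s,
      forall s, 0 <= s <= mdist x y -> mdist (c s) y = mdist x y - s &
      forall s t, 0 <= s <= mdist x y -> 0 <= t <= mdist x y ->
        mdist (c s) (c t) = `|s - t|].
Proof.
move=> [c0 cl cg]; have d0 := mdist_ge0 x y.
have cg' s t : 0 <= s <= mdist x y -> 0 <= t <= mdist x y ->
  mdist (c s) (c t) = `|s - t| by move=> hs ht; rewrite cg//= in_itv.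
split=> // s hs.
  have := cg' 0 s; rewrite c0 lexx d0 => ->//.
  by rewrite sub0r normrN ger0_norm//; lra.
have := cg' s (mdist x y); rewrite cl lexx d0 => ->//.
by rewrite distrC ger0_norm//; lra.
Qed.

Lemma geodesic_segment_dist x y (c : R -> X) s t : geodesic_segment x y c ->
  0 <= s -> s <= t -> t <= mdist x y -> mdist (c s) (c t) = t - s.
Proof.
move=> cs s0 st tl; have [_ _ _ cd] := geodesic_segmentP cs.
rewrite cd; first by rewrite distrC ger0_norm// subr_ge0.
  by rewrite s0 (le_trans st).
by rewrite tl (le_trans s0).
Qed.

Lemma segment_itv0 u v : u <= v -> `[u, v]%classic !=set0.
Proof. by move=> uv; exists u; rewrite /= in_itv/= lexx. Qed.

(** The squared distance to [z] is strictly convex along [c] and smaller at the projection than at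
    [u], hence smaller at all points in between. *)
Lemma gproj_segment_closer (c : R -> X) u v z r : geodesic_on `[u, v] c ->
  u <= v -> u < r <= gproj `[u, v] c z -> mdist z (c r) < mdist z (c u).
Proof.
move=> cg uv; set g := gproj _ _ _ => hr.
have cl : closed `[u, v]%classic by exact: itv_closed.
have gI : `[u, v]%classic g := gproj_in cg cl (segment_itv0 uv) z.
have uI : `[u, v]%classic u by rewrite /= in_itv/= lexx.
have := gproj_obtuse X_CAT0 cg (@interval_is_interval _ _) cl
  (segment_itv0 uv) z uI; rewrite -/g => ob.
have g0 : 0 < g - u by lra.
pose l := (r - u) / (g - u).
have lg : l * (g - u) = r - u by rewrite /l divfK// gt_eqF.
have l0 : 0 < l by rewrite divr_gt0//; lra.
have l1 : l <= 1 by rewrite ler_pdivrMr//; lra.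
have l01 : 0 <= l <= 1 by lra.
have := CN_inequality X_CAT0 z cg (@interval_is_interval _ _) uI gI l01.
have -> : (1 - l) * u + l * g = r.
  have -> : r = (r - u) + u by ring.
  by rewrite -lg; ring.
rewrite -ltr_sqr ?nnegrE ?mdist_ge0//.
move: (mdist _ _) (mdist _ _) (mdist _ _) ob => A B C ob h.
apply: (le_lt_trans h).
have : 0 < l * (u - g) ^+ 2.
  by rewrite mulr_gt0// lt_neqAle sqr_ge0 eq_sym sqrf_eq0 andbT; lra.
nra.
Qed.

(** Every point of [e] has the same projection to [b] as [p], so the obtuse angle there makes it at
    least as far from [b r] as the endpoint of [e] is. *)
Lemma gproj_of_nearest x y p (b e : R -> X) r :
  geodesic_segment x y b ->
  geodesic_segment p (b (gproj `[0, mdist x y] b p)) e ->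
  0 <= r <= mdist x y ->
  gproj `[0, mdist p (b (gproj `[0, mdist x y] b p))] e (b r) =
    mdist p (b (gproj `[0, mdist x y] b p)).
Proof.
move=> bs; have [d0 _ _ bd] := geodesic_segmentP bs; have [_ _ bg] := bs.
set S := gproj _ _ p => es hr; set D := mdist p (b S).
have [D0 ed ed' _] := geodesic_segmentP es; have [_ eD eg] := es.
have cl : closed `[0, mdist x y]%classic by exact: itv_closed.
have : `[0, mdist x y]%classic S := gproj_in bg cl (segment_itv0 d0) p.
rewrite /= in_itv/= => SI.
have rI : `[0, mdist x y]%classic r by rewrite /= in_itv.
apply: (gproj_segment_nearest X_CAT0 eg); split.
  by rewrite /= in_itv/= lexx D0.
move=> s; rewrite /= in_itv/= => hs; rewrite eD.
have sS : gproj `[0, mdist x y] b (e s) = S.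
  apply: (gproj_toward X_CAT0 bg (@interval_is_interval _ _) cl (segment_itv0 d0)).
  by rewrite -/S ed// ed'//; rewrite addrC subrK.
have := gproj_obtuse X_CAT0 bg (@interval_is_interval _ _) cl
  (segment_itv0 d0) (e s) rI; rewrite sS => ob.
rewrite (mdistC (b r) (e s)) -ler_sqr ?nnegrE ?mdist_ge0// bd//.
rewrite -normrX ger0_norm ?sqr_ge0//; apply: le_trans ob.
by rewrite lerDr sqr_ge0.
Qed.

Lemma wall_crossing (a : wall X) (c : R -> X) u v w : geodesic_on `[u, v] c ->
  u <= v -> wfun a (c u) <= w <= wfun a (c v) \/ wfun a (c v) <= w <= wfun a (c u) ->
  exists2 s, u <= s <= v & wfun a (c s) = w.
Proof.
move=> cg uv h; apply: geodesic_IVT => //; first exact: wfun_lip1.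
rewrite ge_min le_max; lra.
Qed.

Lemma geodesic_on_segment x y (c : R -> X) u v : geodesic_segment x y c ->
  0 <= u -> v <= mdist x y -> geodesic_on `[u, v] c.
Proof.
move=> [_ _ cg] u0 vl; apply: geodesic_onW cg => s /=; rewrite !in_itv/=; lra.
Qed.

(* Let [h1], [h2], [h3] be the last three curtains, [p] a point of [al] on [h2]
   and [q] its projection to [be].  Every curtain dual to [[p, q]] has [be] on
   one side and [p] on the other, so it meets [h2].  As [p] lies between points
   of [al] on [h1] and on [h3], one of these two projects to [p] on [[p, q]],
   and then the dual curtains meet [h1], resp. [h3], too. *)
Lemma sepchain_bottleneck k o x y (al be : R -> X) :
  geodesic_segment o x al -> geodesic_segment o y be ->
  sepchain k.+3 [set o] [set x; y] ->
  exists T S, [/\ 0 <= T <= mdist o x, 0 <= S <= mdist o y,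
    mdist (al T) (be S) <= L.+1%:R & sepchain k.+1 [set o] [set al T]].
Proof.
move=> als bes [s [sk ps so sxy]].
case/lastP: s => [|s h3] in ps so sxy sk *; first by [].
case/lastP: s => [|s h2] in ps so sxy sk *; first by [].
case/lastP: s => [|s h1] in ps so sxy sk *; first by [].
move: ps; rewrite pairwise_rcons all_rcons => /andP[/andP[h23 _]].
rewrite pairwise_rcons all_rcons => /andP[/andP[h12 sh2] ps].
have inn h : h \in [:: h1; h2; h3] -> [/\ wfun h o < - 2^-1, 2^-1 < wfun h x & 2^-1 < wfun h y].
  move=> hh; have hin : h \in rcons (rcons (rcons s h1) h2) h3.
    by move: hh; rewrite !(mem_rcons, inE); do 2 (case: eqP => [_|_] //=; rewrite ?orbT//); case: eqP.
  by split; [apply: so|apply: sxy|apply: sxy] => //; [left|right].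
have [h1o h1x h1y] := inn h1 ltac:(by rewrite !inE eqxx).
have [h2o h2x h2y] := inn h2 ltac:(by rewrite !inE eqxx orbT).
have [h3o h3x h3y] := inn h3 ltac:(by rewrite !inE eqxx !orbT).
have [dx0 _ _ ald] := geodesic_segmentP als.
have [dy0 _ _ bed] := geodesic_segmentP bes.
have [al0 all_ alg] := als; have [be0 bel beg] := bes.
have alW u v : 0 <= u -> v <= mdist o x -> geodesic_on `[u, v] al.
  exact: geodesic_on_segment als.
have [|T T01 h2T] := wall_crossing (a := h2) (w := 0) alg dx0.
  by rewrite al0 all_; left; lra.
have h1T : 2^-1 < wfun h1 (al T) by apply: (wltP (wltLW h12)); lra.
have h3T : wfun h3 (al T) < - 2^-1 by apply: (wltLW h23); lra.
have [T1 T101 h1T1] : exists2 r, 0 <= r <= T & wfun h1 (al r) = 0.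
  by apply: wall_crossing; [apply: alW; lra|lra|rewrite al0; left; lra].
have [T3 T301 h3T3] : exists2 r, T <= r <= mdist o x & wfun h3 (al r) = 0.
  by apply: wall_crossing; [apply: alW; lra|lra|rewrite all_; left; lra].
have cross h : wfun h o < - 2^-1 -> 2^-1 < wfun h y ->
    exists2 r, 0 <= r <= mdist o y & wfun h (be r) = 0.
  by move=> ho hy; apply: wall_crossing => //; rewrite be0 bel; left; lra.
have [S1 S101 h1S1] := cross _ h1o h1y.
have [S2 S201 h2S2] := cross _ h2o h2y.
have [S3 S301 h3S3] := cross _ h3o h3y.
set p := al T; pose S := gproj `[0, mdist o y] be p.
have SI : 0 <= S <= mdist o y.
  have cl : closed `[0, mdist o y]%classic by exact: itv_closed.
  by have := gproj_in beg cl (segment_itv0 dy0) p; rewrite /= in_itv.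
exists T, S; split => //; last first.
  (* Only [h2], which contains [al T], and [h3] are given up. *)
  exists (rcons s h1); split=> //.
  - by move: sk; rewrite !size_rcons => -[->].
  - by move=> a u ua; apply: so; rewrite mem_rcons inE mem_rcons inE ua !orbT.
  - move=> a u + ->; rewrite mem_rcons inE => /orP[/eqP-> //|ua].
    have /wltLW ah2 := allP sh2 _ ua.
    by apply: (wltP ah2); rewrite /p h2T; lra.
have [e es] := X_CAT0.1 p (be S); have [e0 el eg] := es.
have [D0 _ _ _] := geodesic_segmentP es.
have mS r : 0 <= r <= mdist o y -> gproj `[0, mdist p (be S)] e (be r) = mdist p (be S).
  exact: gproj_of_nearest bes es.
have cl : closed `[0, mdist p (be S)]%classic by exact: itv_closed.
have mp : gproj `[0, mdist p (be S)] e p = 0.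
  rewrite -{2}e0; apply: (gproj_geodesic X_CAT0 eg (@interval_is_interval _ _) cl).
    exact: segment_itv0.
  by rewrite /= in_itv/= lexx D0.
have mid h r : 0 <= r <= mdist o y -> wfun h (be r) = 0 ->
    forall r', wfun h (al r') = 0 -> gproj `[0, mdist p (be S)] e (al r') = 0 ->
    meets_ends e 0 (mdist p (be S)) h.2.
  move=> hr hbr r' har' gr'; exists (al r'), (be r); split=> //; last exact: mS.
    by apply/(curtain_setE' X_CAT0); rewrite har'; lra.
  by apply/(curtain_setE' X_CAT0); rewrite hbr; lra.
rewrite -[leLHS]subr0.
have m2 := mid _ _ S201 h2S2 _ h2T mp.
have gI z : 0 <= gproj `[0, mdist p (be S)] e z <= mdist p (be S).
  by have := gproj_in eg cl (segment_itv0 D0) z; rewrite /= in_itv.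
have [g1|g1] := eqVneq (gproj `[0, mdist p (be S)] e (al T1)) 0.
  have m1 := mid _ _ S101 h1S1 _ h1T1 g1.
  apply: (Lseparated_dual_length X_CAT0 eg _ m1 m2).
  by have /asboolP[] := h12.
have [g3|g3] := eqVneq (gproj `[0, mdist p (be S)] e (al T3)) 0.
  have m3 := mid _ _ S301 h3S3 _ h3T3 g3.
  apply: (Lseparated_dual_length X_CAT0 eg _ m2 m3).
  by have /asboolP[] := h23.
have {}g1 : 0 < gproj `[0, mdist p (be S)] e (al T1).
  by have := gI (al T1); rewrite lt_neqAle eq_sym g1 => /andP[].
have {}g3 : 0 < gproj `[0, mdist p (be S)] e (al T3).
  by have := gI (al T3); rewrite lt_neqAle eq_sym g3 => /andP[].
(* Otherwise both [al T1] and [al T3] are strictly closer to [e r] than to [p], although [p] lies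
   between them on a geodesic. *)
pose r := Num.min (gproj `[0, mdist p (be S)] e (al T1)) (gproj `[0, mdist p (be S)] e (al T3)).
have r0 : 0 < r by rewrite lt_min g1 g3.
have c1 : mdist (al T1) (e r) < mdist (al T1) (e 0).
  by apply: gproj_segment_closer eg D0 _; rewrite r0 ge_min lexx.
have c3 : mdist (al T3) (e r) < mdist (al T3) (e 0).
  by apply: gproj_segment_closer eg D0 _; rewrite r0 ge_min lexx orbT.
have := mdist_triangle (al T1) (e r) (al T3).
rewrite (mdistC (e r)) => tri.
have /andP[T10 T1T] := T101; have /andP[TT3 T3l] := T301.
have d13 : mdist (al T1) (al T3) = T3 - T1.
  by apply: (geodesic_segment_dist als) => //; exact: le_trans T1T TT3.
have d1 : mdist (al T1) p = T - T1.
  by apply: (geodesic_segment_dist als) => //; exact: le_trans TT3 T3l.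
have d3 : mdist (al T3) p = T3 - T.
  rewrite mdistC; apply: (geodesic_segment_dist als) => //.
  exact: le_trans T10 T1T.
have := le_lt_trans tri (ltrD c1 c3).
by rewrite e0 d13 d1 d3 [ltRHS]addrC addrA subrK ltxx.
Qed.

End Geodesics.

(** * Geodesics passing long chains *)

Section Rays.
Context {R : realType} (X : metricType R) (X_CAT0 : CAT0 X) (L : nat).
Implicit Types (x y z o p q : X) (r s t u v : R).

Local Notation sepchain := (sepchain L).

(* If [be] crosses two L-separated curtains and comes back through both, the
   curtains dual to the excursion meet both, so the excursion has length at most
   [L + 1] and few curtains fit into it. *)
Lemma sepchain_no_backtrack k o x (be : R -> X) T s :
  geodesic_segment o x be -> 0 <= T -> T <= s -> s <= mdist o x ->
  sepchain k [set o] [set be T] ->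
  sepchain (k - L - 3) [set o] [set be T; be s].
Proof.
move=> bes T0 Ts sl [w [wk pw wo wT]].
pose good (a : wall X) := 2^-1 < wfun a (be s).
suff bad : (size (seq.filter (predC good) w) <= L + 3)%N.
  apply: (@sepchain_subseq _ _ L _ _ _ (seq.filter good w)).
  - exact: pairwise_filter.
  - by have := size_filterC good w; lia.
  - by move=> a u; rewrite mem_filter => /andP[_]; exact: wo.
  - move=> a u; rewrite mem_filter => /andP[ga aw] [->|->//].
    exact: wT.
have := pairwise_filter (predC good) pw.
have : forall a, a \in seq.filter (predC good) w ->
  [/\ wfun a o < - 2^-1, 2^-1 < wfun a (be T) & wfun a (be s) <= 2^-1].
  move=> a; rewrite mem_filter /= -leNgt => /andP[ga aw].
  by split=> //; [exact: wo|exact: wT].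
case: (seq.filter _ _) => [|b1 [|b2 t]] bt; [by []|by rewrite addn3|].
have [b1o b1T b1s] := bt b1 ltac:(by rewrite mem_head).
have [b2o b2T b2s] := bt b2 ltac:(by rewrite !inE eqxx orbT).
rewrite /= => /and3P[/andP[b12 _] /allP b2t pt].
have [be0 _ _] := bes.
have beW u v : 0 <= u -> v <= mdist o x -> geodesic_on `[u, v] be.
  exact: geodesic_on_segment bes.
have {}b2s : wfun b2 (be s) < - 2^-1 by apply: (wltLW b12).
have [q q01 b2q] : exists2 r, 0 <= r <= T & wfun b2 (be r) = 0.
  by apply: (wall_crossing X_CAT0); [apply: beW; lra|lra|rewrite be0; left; lra].
have [q' q'01 b2q'] : exists2 r, T <= r <= s & wfun b2 (be r) = 0.
  by apply: (wall_crossing X_CAT0); [apply: beW; lra|lra|right; lra].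
have b1q : 2^-1 < wfun b1 (be q) by apply: (wltP (wltLW b12)); lra.
have b1q' : 2^-1 < wfun b1 (be q') by apply: (wltP (wltLW b12)); lra.
have [p p01 b1p] : exists2 r, 0 <= r <= q & wfun b1 (be r) = 2^-1.
  by apply: (wall_crossing X_CAT0); [apply: beW; lra|lra|rewrite be0; left; lra].
have [p' p'01 b1p'] : exists2 r, q' <= r <= s & wfun b1 (be r) = 2^-1.
  by apply: (wall_crossing X_CAT0); [apply: beW; lra|lra|right; lra].
(* The curtains after [b2] all fit between [be q] and [be T], so they are counted by the length of
   the excursion, at most [L + 1]; with [b1] and [b2] this makes [L + 3]. *)
have qT : (size t)%:R <= T - q.
  have -> : T - q = mdist (be q) (be T).
    by rewrite (geodesic_segment_dist bes)//; clear -q01 Ts sl; lra.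
  apply: (sepchain_dist X_CAT0 (L := L)); exists t; split=> //.
    by move=> a u ta ->; apply: (wltLW (b2t _ ta)); lra.
  move=> a u ta ->; have [] // := bt a.
  by rewrite !inE ta !orbT.
have beq : geodesic_on `[q, q'] be by apply: beW; lra.
have near r r' : 0 <= r <= s -> q <= r' <= q' -> (r <= q /\ r' = q) \/ (q' <= r /\ r' = q') ->
    gproj `[q, q'] be (be r) = r'.
  move=> hr hr' hh; apply: (gproj_segment_nearest X_CAT0 beq); split.
    by rewrite /= in_itv.
  move=> r''; rewrite /= in_itv/= => hr''.
  rewrite !(beW 0 s)//= ?in_itv/=; clear -hr hr' hr'' hh Ts q01 q'01 sl; try lra.
  by case: hh => -[h ->]; [rewrite !ler0_norm|rewrite !ger0_norm]; lra.
have m1 : meets_ends be q q' b1.2.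
  exists (be p), (be p'); split; try (apply: near; clear -p01 p'01 q01 q'01 Ts; lra).
    by apply/(curtain_setE' X_CAT0); rewrite b1p; lra.
  by apply/(curtain_setE' X_CAT0); rewrite b1p'; lra.
have m2 : meets_ends be q q' b2.2.
  exists (be q), (be q'); split; try (apply: near; clear -p01 p'01 q01 q'01 Ts; lra).
    by apply/(curtain_setE' X_CAT0); rewrite b2q; lra.
  by apply/(curtain_setE' X_CAT0); rewrite b2q'; lra.
have /asboolP[_ L12] := b12.
have := Lseparated_dual_length X_CAT0 beq L12 m1 m2.
have : (size t)%:R <= q' - q by lra.
by move=> h /(le_trans h); rewrite ler_nat /= addn3 !ltnS.
Qed.

(** The bottleneck point of [be] is within [L + 1] of the geodesic [o, x], so it occurs before time
    [T], and [be] cannot undo the chain afterwards. The bottleneck costs 2 curtains and backtracking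
    [L + 3]. The minimum keeps the time in the domain of [be]. *)
Lemma sepchain_past k o x y (be : R -> X) T :
  geodesic_segment o y be -> mdist o x + L.+1%:R <= T ->
  sepchain k [set o] [set x; y] ->
  sepchain (k - L - 5) [set o] [set be (Num.min T (mdist o y))].
Proof.
move=> bes hT hk; have [k3|k3] := leqP k 2.
  by rewrite (_ : (k - L - 5)%N = 0)//; [exact: sepchain0|lia].
have [al als] := X_CAT0.1 o x.
have hk' : sepchain (k - 3).+3 [set o] [set y; x].
  by rewrite setUC (_ : (k - 3).+3 = k)//; lia.
have [T0 [S [T01 S01 dTS hT0]]] := sepchain_bottleneck X_CAT0 bes als hk'.
have [_ bed _ _] := geodesic_segmentP bes.
have [_ ald _ _] := geodesic_segmentP als.
have := mdist_triangle o (al S) (be T0).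
rewrite (bed _ T01) (ald _ S01) (mdistC (al S)) => tri.
have T0T : T0 <= T by move: S01 => /andP[_ S1]; clear -tri hT dTS S1; lra.
have T0' : T0 <= Num.min T (mdist o y) by rewrite le_min T0T; case/andP: T01.
have [T00 _] := andP T01.
have mo : Num.min T (mdist o y) <= mdist o y by rewrite ge_min lexx orbT.
have := sepchain_no_backtrack bes T00 T0' mo hT0.
move=> /sepchainW; apply; [|by []|by move=> w ->; right].
by clear -k3; lia.
Qed.

(** At the bottleneck, at a time [U] of at least [k - L], the geodesics are at distance at most
    [2 * (L + 1)]; convexity scales this by [t / U] at time [t]. *)
Lemma sepchain_fellow_travel k o x y (al be : R -> X) (t e : R) :
  geodesic_segment o x al -> geodesic_segment o y be ->
  sepchain k.+3 [set o] [set x; y] -> 0 <= e ->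
  0 <= t -> t + L%:R <= k%:R -> t * (2 * L.+1%:R) <= e * (k%:R - L%:R) ->
  [/\ t <= mdist o x, t <= mdist o y & mdist (al t) (be t) <= e].
Proof.
move=> als bes hk e0 t0 tk te.
have [T [S [T01 S01 dTS hT]]] := sepchain_bottleneck X_CAT0 als bes hk.
have [_ ald _ _] := geodesic_segmentP als.
have [dy0 bed _ bedd] := geodesic_segmentP bes.
have kT : k%:R + 1 <= T.
  by have := sepchain_dist X_CAT0 hT; rewrite (ald _ T01) -natr1.
have := mdist_triangle o (al T) (be S); have := mdist_triangle o (be S) (al T).
rewrite (bed _ S01) (ald _ T01) (mdistC (be S)) => tri1 tri2.
move: dTS te; rewrite -natr1 => dTS te.
pose U := Num.min T S.
have [UT US] : U <= T /\ U <= S by rewrite !ge_min !lexx orbT.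
have kU : k%:R - L%:R <= U by rewrite le_min; clear -tri1 tri2 kT dTS; lra.
have /andP[T0 Tl] := T01; have /andP[S0 Sl] := S01.
have U0 : 0 <= U by rewrite le_min T0 S0.
have tU : t <= U by clear -tk kU; lra.
have Ux : U <= mdist o x := le_trans UT Tl.
have Uy : U <= mdist o y := le_trans US Sl.
split; [exact: le_trans Ux|exact: le_trans Uy|].
have dU : mdist (al U) (be U) <= 2 * (L%:R + 1).
  rewrite /U; case: (leP T S) => TS.
    have := mdist_triangle (al T) (be S) (be T); rewrite (mdistC (be S)).
    rewrite (geodesic_segment_dist bes T0 TS Sl); clear -tri1 tri2 dTS; lra.
  have := mdist_triangle (al S) (al T) (be S).
  rewrite (geodesic_segment_dist als S0 (ltW TS) Tl); clear -tri1 tri2 dTS; lra.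
have [al0 _ alg] := als; have [be0 _ beg] := bes.
have [U00|Upos] := eqVneq U 0.
  have -> : t = 0 by apply: le_anti; rewrite t0 -U00 tU.
  by rewrite al0 be0 mdistxx.
have {}Upos : 0 < U by rewrite lt_neqAle eq_sym Upos.
pose l := t / U.
have lU : l * U = t by rewrite /l divfK// gt_eqF.
have l0 : 0 <= l by rewrite divr_ge0.
have l1 : l <= 1 by rewrite ler_pdivrMr// mul1r.
have i0 z : `[0, mdist o z]%classic (0 : R) by rewrite /= in_itv/= lexx mdist_ge0.
have iUx : `[0, mdist o x]%classic U by rewrite /= in_itv/= U0 Ux.
have iUy : `[0, mdist o y]%classic U by rewrite /= in_itv/= U0 Uy.
have ab0 : al 0 = be 0 by rewrite al0 be0.
have l01 : 0 <= l <= 1 by rewrite l0 l1.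
have := geodesic_convex X_CAT0 alg (@interval_is_interval _ _) (i0 x) iUx
  beg (@interval_is_interval _ _) (i0 y) iUy ab0 l01.
rewrite mulr0 add0r lU => /le_trans; apply.
have := ler_wpM2l l0 dU => /le_trans; apply.
rewrite -(ler_pM2r Upos) mulrAC lU (le_trans te)//.
exact: ler_wpM2l.
Qed.

End Rays.

(** * Isometries *)

Section Isometries.
Context {R : realType} (X : metricType R).
Implicit Types (x y z : X) (g : X -> X).

Lemma isometry_inverse g : Defs.isometry g ->
  exists g', [/\ Defs.isometry g', cancel g g' & cancel g' g].
Proof.
move=> [[g' gK g'K] gd]; exists g'; split=> //; split; first by exists g.
by move=> x y; rewrite -gd !g'K.
Qed.

Lemma geodesic_on_isometry g (I : set R) (c : R -> X) :
  Defs.isometry g -> geodesic_on I c -> geodesic_on I (g \o c).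
Proof. by move=> [_ gd] cg s t sI tI /=; rewrite gd cg. Qed.

Definition curtain_map g (gi : Defs.isometry g) (h : curtain X) : curtain X :=
  Curtain (@curtain_dom_interval _ _ h) (@curtain_dom_closed _ _ h)
    (geodesic_on_isometry gi (@curtain_geodesic _ _ h)) (@curtain_pos_dom _ _ h).

Section Transport.
Variables (g g' : X -> X) (gi : Defs.isometry g).
Hypotheses (gK : cancel g g') (g'K : cancel g' g).

Lemma proj_preimage_map (I : set R) (c : R -> X) (J : set R) :
  proj_preimage I (g \o c) J = g' @^-1` proj_preimage I c J.
Proof.
have e x r : mdist x (g (c r)) = mdist (g' x) (c r).
  by rewrite -{1}(g'K x) gi.2.
by apply/seteqP; split=> x /= [s [Js Is sP]]; exists s; split=> // r /sP;
  rewrite /= !e.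
Qed.

Lemma curtain_set_map h :
  curtain_set (curtain_map gi h) = g' @^-1` curtain_set h.
Proof. exact: proj_preimage_map. Qed.

Lemma separates_map h (A B : set X) : separates h A B ->
  separates (curtain_map gi h) (g' @^-1` A) (g' @^-1` B).
Proof.
rewrite /separates /halfspace_minus /halfspace_plus !proj_preimage_map.
by case=> -[hA hB]; [left|right]; split=> x; [exact: hA|exact: hB|exact: hA|exact: hB].
Qed.

Lemma chain_map n (c : 'I_n -> curtain X) :
  chain c -> chain (fun i => curtain_map gi (c i)).
Proof.
move=> [cinj cs]; split=> [i j /=|i j k ij jk]; rewrite !curtain_set_map.
  move=> e; apply: cinj; apply/funext => x.
  by have := congr1 (fun A => A (g x)) e; rewrite /preimage /= gK.
exact: separates_map (cs _ _ _ ij jk).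
Qed.

End Transport.

(** A chain meeting the two images is carried back by the inverse isometry. *)
Lemma Lseparated_map L g (gi : Defs.isometry g) h k :
  Lseparated L h k -> Lseparated L (curtain_map gi h) (curtain_map gi k).
Proof.
have [g' [g'i gK g'K]] := isometry_inverse gi.
move=> [hk0 hk]; split.
  by rewrite !(curtain_set_map gi g'K) -preimage_setI hk0 preimage_set0.
move=> n c cc ch ck; apply: (hk _ (fun i => curtain_map g'i (c i))).
- exact: (chain_map g'i g'K gK cc).
- move=> i; have [x [cx]] := ch i; rewrite (curtain_set_map gi g'K) => hx.
  by exists (g' x); split=> //; rewrite (curtain_set_map g'i gK) /= g'K.
- move=> i; have [x [cx]] := ck i; rewrite (curtain_set_map gi g'K) => hx.
  by exists (g' x); split=> //; rewrite (curtain_set_map g'i gK) /= g'K.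
Qed.

Lemma Lchain_sizes_isometry L g x y n : Defs.isometry g ->
  Lchain_sizes L x y n -> Lchain_sizes L (g x) (g y) n.
Proof.
move=> gi [c [[cc cL] cxy]]; have [g' [g'i gK g'K]] := isometry_inverse gi.
exists (fun i => curtain_map gi (c i)); split; first split.
- exact: (chain_map gi gK g'K cc).
- by move=> i j ij; apply: Lseparated_map; exact: cL.
- move=> i; have := separates_map gi g'K (cxy i).
  have pre z : g' @^-1` [set z] = [set g z].
    by apply/seteqP; split=> w /= => [<-|->]; rewrite ?g'K ?gK.
  by rewrite !pre.
Qed.

Lemma dL_isometry L g x y : Defs.isometry g -> dL L (g x) (g y) = dL L x y.
Proof.
move=> gi; have [g' [g'i gK g'K]] := isometry_inverse gi.
rewrite /dL (can_eq gK); case: eqP => // _; congr (1 + sup _).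
congr (image _ _); apply/seteqP; split=> n.
  by move=> /(Lchain_sizes_isometry g'i); rewrite !gK.
exact: Lchain_sizes_isometry.
Qed.

End Isometries.

Section GromovIsometries.
Context {R : realType} (X : metricType R) (X_CAT0 : CAT0 X) (L : nat).

(** Up to isometry [g] only moves the basepoint to [g o]; the coarse triangle inequality bounds the
    effect on both distances to it. *)
Lemma gromov_product_isometry (o x y : X) g : Defs.isometry g ->
  gromov_product L o x y - (dL L o (g o) + 2) <= gromov_product L o (g x) (g y).
Proof.
move=> gi; rewrite /gromov_product dL_isometry//.
have := dL_coarse_triangle X_CAT0 L (g x) o (g o).
have := dL_coarse_triangle X_CAT0 L (g y) o (g o).
by rewrite !dL_isometry//; lra.
Qed.

End GromovIsometries.

(** * Sequences converging to the Gromov boundary *)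

Section EventualBounds.
Context {R : realType}.
Local Open Scope ereal_scope.

Lemma limn_einf_gt (w : nat -> \bar R) (l : \bar R) : l < limn_einf w ->
  exists N, forall i, (N <= i)%N -> l < w i.
Proof.
rewrite /limn_einf /limn_esup limf_esupE lteNr => /ereal_inf_lt[_ [V [N _ NV] <-]].
move=> Vl; exists N => i Ni; rewrite -lteN2; apply: le_lt_trans Vl.
by apply: ereal_sup_ubound; exists i => //; exact: NV.
Qed.

Lemma limn_einf_ge (w : nat -> \bar R) (l : \bar R) N :
  (forall i, (N <= i)%N -> l <= w i) -> l <= limn_einf w.
Proof.
move=> lw; rewrite /limn_einf /limn_esup limf_esupE leeNr.
apply: (@le_trans _ _ (ereal_sup ((\- w) @` [set i | (N <= i)%N]))).
  by apply: ereal_inf_lbound; exists [set i | (N <= i)%N] => //; exists N.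
by apply: ge_ereal_sup => _ [i Ni <-]; rewrite leeN2; exact: lw.
Qed.

End EventualBounds.

Section Sequences.
Context {R : realType} (X : metricType R) (X_CAT0 : CAT0 X) (L : nat) (o : X).
Implicit Types (u v w : nat -> X) (x y z : X).

Local Notation sepchain := (sepchain L).

(* In terms of chains, [u] and [v] converge to the same boundary point. *)
Definition cofinal u v := forall k, exists N, forall i j,
  (N <= i)%N -> (N <= j)%N -> sepchain k [set o] [set u i; v j].

Lemma cofinalC u v : cofinal u v -> cofinal v u.
Proof.
by move=> uv k; have [N uvN] := uv k; exists N => i j Ni Nj; rewrite setUC; exact: uvN.
Qed.

Lemma cofinal_trans v u w : cofinal u v -> cofinal v w -> cofinal u w.
Proof.
move=> uv vw k; have [N uvN] := uv (k + L + 1)%N; have [M vwM] := vw (k + L + 1)%N.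
exists (maxn N M) => i j; rewrite !geq_max => /andP[Ni Mi] /andP[Nj Mj].
have := sepchain_hyperbolic X_CAT0 (uvN i (maxn N M) Ni (leq_maxl _ _))
  (vwM (maxn N M) j (leq_maxr _ _) Mj).
by rewrite (_ : (k + L + 1 - L - 1)%N = k)//; lia.
Qed.

Lemma sepchain_of_gromov_product k x y :
  k%:R + (L + 3)%:R <= gromov_product L o x y -> sepchain k [set o] [set x; y].
Proof.
move=> kxy; have [m hm mxy] := gromov_product_sepchain X_CAT0 L o x y.
have : k%:R <= (m%:R : R) by lra.
by rewrite ler_nat => km; apply: (sepchainW hm).
Qed.

Lemma converges_cofinal u : converges_at_infinity L o u <-> cofinal u u.
Proof.
split=> [/cvgryPge cu k|uu].
  have [[A B] [[N _ NA] [M _ MB]] AB] := cu (k%:R + (L + 3)%:R).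
  exists (maxn N M) => i j; rewrite !geq_max => /andP[Ni Mi] /andP[Nj Mj].
  apply: sepchain_of_gromov_product; apply: (AB (i, j)); split => /=.
    exact: NA.
  exact: MB.
apply/cvgryPge => A; have [N uN] := uu (Num.bound `|A| + (L + 3))%N.
exists ([set i | (N <= i)%N], [set i | (N <= i)%N]).
  by split; exists N.
move=> [i j] [/= Ni Nj].
have := sepchain_gromov_product X_CAT0 (uN i j Ni Nj).
rewrite natrD addrK; apply: le_trans.
by rewrite (le_trans (ler_norm _))// ltW// archi_boundP.
Qed.

Lemma gromov_equivP u v : gromov_equiv L o u v <->
  forall k, exists N, forall i, (N <= i)%N -> sepchain k [set o] [set u i; v i].
Proof.
split=> [/cvgryPge cu k|uv].
  have [N _ NA] := cu (k%:R + (L + 3)%:R).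
  by exists N => i Ni; apply: sepchain_of_gromov_product; exact: NA.
apply/cvgryPge => A; have [N uN] := uv (Num.bound `|A| + (L + 3))%N.
exists N => // i Ni.
have := sepchain_gromov_product X_CAT0 (uN i Ni).
rewrite natrD addrK; apply: le_trans.
by rewrite (le_trans (ler_norm _))// ltW// archi_boundP.
Qed.

Lemma cofinal_equiv u v : cofinal u v -> gromov_equiv L o u v.
Proof.
move=> uv; apply/gromov_equivP => k; have [N uvN] := uv k.
by exists N => i Ni; exact: uvN.
Qed.

(** Equivalence compares equal indices only; going from [u i] through [u j] to [v j] makes the
    indices independent, at the price [L + 1] of hyperbolicity. *)
Lemma equiv_cofinal u v : cofinal u u -> gromov_equiv L o u v -> cofinal u v.
Proof.
move=> uu /gromov_equivP uv k.
have [N uuN] := uu (k + L + 1)%N; have [M uvM] := uv (k + L + 1)%N.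
exists (maxn N M) => i j; rewrite !geq_max => /andP[Ni Mi] /andP[Nj Mj].
have := sepchain_hyperbolic X_CAT0 (uuN i j Ni Nj) (uvM j Mj).
by rewrite (_ : (k + L + 1 - L - 1)%N = k)//; lia.
Qed.

Implicit Types xi eta : gromov_boundary L o.

Lemma gromov_boundary_rep xi : exists u, [/\ cofinal u u, val xi u &
  forall v, val xi v <-> cofinal u v].
Proof.
have [u cu xiE] := set_valP xi; have uu := (converges_cofinal u).1 cu.
have xiP v : val xi v <-> cofinal u v.
  rewrite -xiE /=; split=> [[cv uv]|uv]; first exact: equiv_cofinal.
  split; last exact: cofinal_equiv.
  apply/converges_cofinal; apply: (cofinal_trans (v := u)) => //.
  exact: cofinalC.
by exists u; split=> //; apply/xiP.
Qed.

Lemma gromov_boundary_cofinal xi u v : val xi u -> val xi v <-> cofinal u v.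
Proof.
have [w [ww _ xiP]] := gromov_boundary_rep xi => /xiP wu; split=> [/xiP wv|uv].
  exact: cofinal_trans (cofinalC wu) wv.
by apply/xiP; exact: cofinal_trans uv.
Qed.

Lemma gromov_boundary_eq xi eta u v :
  val xi u -> val eta v -> cofinal u v -> xi = eta.
Proof.
move=> xiu etav uv; apply: val_inj; apply/seteqP; split=> w.
  move=> /(gromov_boundary_cofinal _ xiu) uw.
  by apply/(gromov_boundary_cofinal _ etav); exact: cofinal_trans (cofinalC uv) uw.
move=> /(gromov_boundary_cofinal _ etav) vw.
by apply/(gromov_boundary_cofinal _ xiu); exact: cofinal_trans uv vw.
Qed.

Lemma gromov_boundary_make u : cofinal u u ->
  exists2 xi : gromov_boundary L o, val xi u & forall v, val xi v <-> cofinal u v.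
Proof.
move=> uu.
have cl : classes (converges_at_infinity L o) (gromov_equiv L o)
    [set v | converges_at_infinity L o v /\ gromov_equiv L o u v].
  by exists u => //; apply/converges_cofinal.
exists (SigSub (mem_set cl)).
  by split; [apply/converges_cofinal|exact: cofinal_equiv].
move=> v; split=> /= [[cv uv]|uv]; first exact: equiv_cofinal.
split; last exact: cofinal_equiv.
apply/converges_cofinal; apply: (cofinal_trans (v := u)) => //.
exact: cofinalC.
Qed.

Lemma boundary_product_gt xi eta (r : R) : (r%:E < boundary_product xi eta)%E ->
  exists u v N, [/\ val xi u, val eta v &
    forall i, (N <= i)%N -> r < gromov_product L o (u i) (v i)].
Proof.
move=> /ereal_sup_gt[_ [u [v [xiu etav ->]]] /limn_einf_gt[N rN]].
by exists u, v, N; split=> // i /rN; rewrite lte_fin.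
Qed.

Lemma boundary_product_ge xi eta u v N (r : R) : val xi u -> val eta v ->
  (forall i, (N <= i)%N -> r <= gromov_product L o (u i) (v i)) ->
  (r%:E <= boundary_product xi eta)%E.
Proof.
move=> xiu etav rN.
apply: (@le_trans _ _ (limn_einf (fun i => (gromov_product L o (u i) (v i))%:E))).
  by apply: (@limn_einf_ge _ _ _ N) => i Ni; rewrite lee_fin; exact: rN.
by apply: ereal_sup_ubound; exists u, v.
Qed.

End Sequences.

(** * Rays and the cone topology *)

Section VisualRays.
Context {R : realType} (X : metricType R) (X_CAT0 : CAT0 X) (o : X).
Implicit Types (c e : R -> X) (r s t : R) (zeta : visual_boundary o).

Lemma asymptotic_refl c : asymptotic c c.
Proof. by exists 0 => t _; rewrite mdistxx. Qed.

Lemma asymptoticC c e : asymptotic c e -> asymptotic e c.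
Proof. by move=> [K ce]; exists K => t /ce; rewrite mdistC. Qed.

Lemma asymptotic_trans e c c' : asymptotic c e -> asymptotic e c' -> asymptotic c c'.
Proof.
move=> [K ce] [K' ec']; exists (K + K') => t t0.
by apply: (le_trans (mdist_triangle _ (e t) _)); rewrite lerD ?ce ?ec'.
Qed.

Lemma visual_boundaryE zeta c : val zeta c ->
  val zeta = [set e | ray e /\ asymptotic c e].
Proof.
have [c0 _ <-] := set_valP zeta => -[_ c0c]; apply/seteqP; split=> e [re h].
  by split=> //; apply: asymptotic_trans h; exact: asymptoticC.
by split=> //; exact: asymptotic_trans h.
Qed.

Lemma visual_boundary_ray zeta c : val zeta c -> ray c.
Proof. by have [c0 _ <-] := set_valP zeta => -[]. Qed.

Lemma visual_boundary_make c : ray c -> exists zeta, val zeta c.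
Proof.
move=> rc; have cl : classes (@ray R X) (@asymptotic R X) [set e | ray e /\ asymptotic c e].
  by exists c.
by exists (SigSub (mem_set cl)); split=> //; exact: asymptotic_refl.
Qed.

Lemma ray_dist_le c e t s : ray c -> ray e -> c 0 = e 0 ->
  0 <= t <= s -> 0 < s -> mdist (c t) (e t) <= t / s * mdist (c s) (e s).
Proof.
move=> rc re ce ts s0; have [t0 ts'] := andP ts.
have I0 r : 0 <= r -> `[0, +oo[%classic r by rewrite /= in_itv/= andbT.
have l01 : 0 <= t / s <= 1.
  by rewrite divr_ge0 ?(ltW s0)//= ler_pdivrMr// mul1r.
have := geodesic_convex X_CAT0 rc (@interval_is_interval _ _) (I0 0 (lexx _))
  (I0 s (ltW s0)) re (@interval_is_interval _ _) (I0 0 (lexx _)) (I0 s (ltW s0)) ce l01.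
by rewrite mulr0 add0r divfK// gt_eqF.
Qed.

Lemma ray_dist_mono c e t s : ray c -> ray e -> c 0 = e 0 ->
  0 <= t <= s -> mdist (c t) (e t) <= mdist (c s) (e s).
Proof.
move=> rc re ce ts; have [t0 ts'] := andP ts.
have [->//|ns] := eqVneq t s.
have s0 : 0 < s by rewrite (le_lt_trans t0)// lt_neqAle ns.
apply: (le_trans (ray_dist_le rc re ce ts s0)).
by rewrite ler_piMl ?mdist_ge0// ler_pdivrMr// mul1r.
Qed.

Lemma ray_unique c e t : ray c -> ray e -> c 0 = e 0 -> asymptotic c e ->
  0 <= t -> c t = e t.
Proof.
move=> rc re ce [K cK] t0; apply: mdist_positivity; apply: le_anti.
rewrite mdist_ge0 andbT; apply/ler_addgt0Pr => d d0; rewrite add0r.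
have K0 : 0 <= K := le_trans (mdist_ge0 _ _) (cK _ t0).
(* Chosen so that [t / s * K] is at most [d]; the summand 1 makes [s] positive. *)
pose s := t + t * K / d + 1.
have tK : 0 <= t * K / d by rewrite divr_ge0 ?mulr_ge0// ltW.
have ts : 0 <= t <= s by rewrite t0 /s; lra.
have s0 : 0 < s by rewrite /s; lra.
apply: (le_trans (ray_dist_le rc re ce ts s0)).
apply: (@le_trans _ _ (t / s * K)).
  by apply: ler_wpM2l; [rewrite divr_ge0// ltW|apply: cK; exact: ltW].
rewrite mulrAC ler_pdivrMr//.
have : d * (t * K / d) = t * K by rewrite mulrC divfK// gt_eqF.
rewrite /s; nra.
Qed.

(** Convexity from the common end [y] compares points at equal proportions within [mdist o p];
    passing to equal times costs at most the difference of the lengths, again [mdist o p]. *)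
Lemma geodesic_fellow_common_end p y (al be : R -> X) t :
  geodesic_segment o y al -> geodesic_segment p y be ->
  0 <= t -> t <= mdist o y -> t <= mdist p y ->
  mdist (al t) (be t) <= 2 * mdist o p.
Proof.
move=> als bes t0 ta tb.
have [al0 all_ alg] := als; have [be0 bel beg] := bes.
have op := mdist_ge0 o p.
have [oy|oy] := eqVneq (mdist o y) 0.
  have -> : t = 0 by apply: le_anti; rewrite t0 -oy ta.
  by rewrite al0 be0; lra.
have {}oy : 0 < mdist o y by rewrite lt_neqAle eq_sym oy mdist_ge0.
have tri1 := mdist_triangle o p y; have tri2 := mdist_triangle p o y.
rewrite (mdistC p o) in tri2.
set a := mdist o y in als all_ alg ta oy tri1 tri2 *.
set b := mdist p y in bes bel beg tb tri1 tri2 *.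
have b0 : 0 <= b := mdist_ge0 _ _.
pose l := (a - t) / a.
have l0 : 0 <= l by rewrite divr_ge0 ?subr_ge0// ltW.
have l1 : l <= 1 by rewrite ler_pdivrMr// mul1r; lra.
have l01 : 0 <= l <= 1 by rewrite l0 l1.
have la : l * a = a - t by rewrite /l divfK// gt_eqF.
have I0 (z : R) : 0 <= z -> `[0, z]%classic (0 : R) by move=> z0; rewrite /= in_itv/= lexx.
have I1 (z : R) : 0 <= z -> `[0, z]%classic z by move=> z0; rewrite /= in_itv/= lexx andbT.
have yy : al a = be b by rewrite all_ bel.
have := geodesic_convex X_CAT0 alg (@interval_is_interval _ _) (I1 _ (ltW oy)) (I0 _ (ltW oy))
  beg (@interval_is_interval _ _) (I1 _ b0) (I0 _ b0) yy l01.
rewrite !mulr0 !addr0 al0 be0 (_ : (1 - l) * a = t); last by rewrite mulrBl la mul1r; ring.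
move=> h; have {}h : mdist (al t) (be ((1 - l) * b)) <= mdist o p.
  by apply: (le_trans h); rewrite ler_piMl.
have hb : 0 <= (1 - l) * b by rewrite mulr_ge0// subr_ge0.
have hb' : (1 - l) * b <= b by rewrite ler_piMl//; lra.
have := mdist_triangle (al t) (be ((1 - l) * b)) (be t).
rewrite (beg _ t) /= ?in_itv/= ?hb ?hb' ?t0 ?tb//.
have : `|(1 - l) * b - t| <= mdist o p.
  have -> : (1 - l) * b - t = (1 - l) * (b - a).
    by clear -la; lra.
  rewrite normrM ger0_norm ?subr_ge0//.
  apply: (@le_trans _ _ `|b - a|).
    by rewrite ler_piMl ?normr_ge0//; lra.
  by rewrite ler_norml; lra.
lra.
Qed.

Lemma visual_boundary_from_o zeta c : val zeta c -> c 0 = o ->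
  forall e, val zeta e -> e 0 = o -> forall t, 0 <= t -> c t = e t.
Proof.
move=> zc c0 e ze e0 t t0; apply: ray_unique => //.
- exact: visual_boundary_ray zc.
- exact: visual_boundary_ray ze.
- by rewrite c0.
- by move: ze; rewrite (visual_boundaryE zc) => -[].
Qed.

(** By convexity the distance of rays from [o] grows with time, so the last time decides; by
    uniqueness any representatives from [o] may be used. *)
Lemma cone_nbhdP zeta zeta' (r e : R) c c' : 0 <= r ->
  val zeta c -> c 0 = o -> val zeta' c' -> c' 0 = o ->
  cone_nbhd zeta r e zeta' <-> mdist (c r) (c' r) < e.
Proof.
move=> r0 zc c0 zc' c'0.
have rc := visual_boundary_ray zc; have rc' := visual_boundary_ray zc'.
split=> [[b [b' [[zb b0] [zb' b'0] bb']]]|cc'].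
  rewrite (visual_boundary_from_o zc c0 zb b0 r0).
  rewrite (visual_boundary_from_o zc' c'0 zb' b'0 r0).
  by apply: bb'; rewrite r0 lexx.
exists c, c'; split=> // t tr; apply: le_lt_trans cc'.
by apply: ray_dist_mono => //; rewrite c0.
Qed.

Lemma cone_nbhd_open zeta (r e : R) : 0 <= r -> cone_open (cone_nbhd zeta r e).
Proof.
move=> r0 z' [c [c' [[zc c0] [zc' c'0] h]]].
have cr : mdist (c r) (c' r) < e by apply: h; rewrite r0 lexx.
exists r, (e - mdist (c r) (c' r)); split; first by rewrite subr_gt0.
move=> z'' [b [b' [[zb b0] [zb' b'0] h']]].
apply/(cone_nbhdP _ r0 zc c0 zb' b'0).
have := h' r; rewrite r0 lexx => /(_ isT).
rewrite -(visual_boundary_from_o zc' c'0 zb b0 r0).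
have := mdist_triangle (c r) (c' r) (b' r); lra.
Qed.

End VisualRays.

(** * The boundary map *)

Section LimitRay.
Context {R : realType} (X : metricType R) (X_CAT0 : CAT0 X) (L : nat) (o : X).
Variable geo : X -> R -> X.
Hypothesis geoP : forall y, geodesic_segment o y (geo y).
Implicit Types (u v : nat -> X) (x y : X) (c : R -> X) (s t e : R).

Local Notation sepchain := (sepchain L).

Definition tends_to_ray u c := forall t e, 0 <= t -> 0 < e ->
  exists N, forall i, (N <= i)%N ->
    t <= mdist o (u i) /\ mdist (geo (u i) t) (c t) <= e.

(** That [k] does not depend on [x] and [y] is what yields both the Cauchy property and the
    continuity of the boundary map. *)
Lemma sepchain_fellow_uniform t e : 0 <= t -> 0 < e -> exists k, forall x y,
  sepchain k [set o] [set x; y] -> [/\ t <= mdist o x, t <= mdist o y &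
    forall s, 0 <= s <= t -> mdist (geo x s) (geo y s) <= e].
Proof.
move=> t0 e0; pose b := t * (2 * L.+1%:R) / e.
have b0 : 0 <= b by rewrite divr_ge0 ?mulr_ge0// ltW.
pose n := Num.bound (t + b).
have tbn : t + b <= n%:R by rewrite ltW// archi_boundP// addr_ge0.
have be : e * b = t * (2 * L.+1%:R) by rewrite mulrC divfK// gt_eqF.
exists (n + L).+3 => x y hk.
have main s : 0 <= s <= t ->
    [/\ s <= mdist o x, s <= mdist o y & mdist (geo x s) (geo y s) <= e].
  move=> /andP[s0 st].
  apply: (sepchain_fellow_travel X_CAT0 (geoP x) (geoP y) hk (ltW e0) s0).
    by rewrite natrD lerD2r; lra.
  rewrite natrD addrK; apply: (@le_trans _ _ (t * (2 * L.+1%:R))).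
    by rewrite ler_wpM2r// mulr_ge0.
  by rewrite -be ler_pM2l//; lra.
split; [| |by move=> s /main[]].
- by have [] := main t; rewrite ?t0 ?lexx.
- by have [] := main t; rewrite ?t0 ?lexx.
Qed.

Lemma cofinal_fellow u v t e : cofinal L o u v -> 0 <= t -> 0 < e ->
  exists N, forall i j, (N <= i)%N -> (N <= j)%N ->
    [/\ t <= mdist o (u i), t <= mdist o (v j) &
        mdist (geo (u i) t) (geo (v j) t) <= e].
Proof.
move=> uv t0 e0; have [k hk] := sepchain_fellow_uniform t0 e0.
have [N hN] := uv k; exists N => i j Ni Nj.
have [h1 h2 h3] := hk _ _ (hN i j Ni Nj).
by split=> //; apply: h3; rewrite t0 lexx.
Qed.

Lemma tends_to_ray_cofinal u v c : cofinal L o u v -> tends_to_ray u c ->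
  tends_to_ray v c.
Proof.
move=> uv uc t e t0 e0; have e2 : 0 < e / 2 by rewrite divr_gt0.
have [N uvN] := cofinal_fellow uv t0 e2; have [M ucM] := uc t _ t0 e2.
exists (maxn N M) => i; rewrite geq_max => /andP[Ni Mi].
have [_ tv d1] := uvN i i Ni Ni; have [_ d2] := ucM i Mi; split=> //.
have := mdist_triangle (geo (v i) t) (geo (u i) t) (c t).
by rewrite (mdistC (geo (v i) t) (geo (u i) t)); clear -d1 d2; lra.
Qed.

Lemma tends_to_ray_exists u : complete_space X -> cofinal L o u u ->
  exists c, [/\ ray c, c 0 = o & tends_to_ray u c].
Proof.
move=> Xc uu.
have lim t : exists x, 0 <= t -> forall e, 0 < e -> exists N, forall i, (N <= i)%N ->
    t <= mdist o (u i) /\ mdist (geo (u i) t) x <= e.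
  have [t0|t0] := leP 0 t; last by exists o.
  pose F := (fun i => geo (u i) t) @ \oo.
  have cF : cauchy F.
    apply: cauchy_exP => e e0; have e2 : 0 < e / 2 by rewrite divr_gt0.
    have [N uN] := cofinal_fellow uu t0 e2.
    exists (geo (u N) t); exists N => // i Ni /=.
    rewrite ballEmdist /=; have [_ _ h] := uN N i (leqnn N) Ni.
    by rewrite (le_lt_trans h)// ltr_pdivrMr// ltr_pMr// ltr1n.
  have [x Fx] := Xc F _ cF; exists x => _ e e0.
  have [N uN] := cofinal_fellow uu t0 e0.
  have [M _ MF] : F (ball x e) by apply: Fx; exact: nbhsx_ballx.
  exists (maxn N M) => i; rewrite geq_max => /andP[Ni Mi]; split.
    by have [] := uN i i Ni Ni.
  by have := MF i Mi; rewrite /= ballEmdist /= mdistC => /ltW.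
have [c cP] := choice lim.
have uc : tends_to_ray u c by move=> t e t0; exact: cP.
exists c; split=> //.
- move=> s t; rewrite /= !in_itv/= !andbT => s0 t0.
  (* [c] is only a pointwise limit; that it preserves distances is checked up to every [e]. *)
  have close e : 0 < e -> `|mdist (c s) (c t) - `|s - t| | <= 2 * e.
    move=> e0; have [N hN] := uc s e s0 e0; have [M hM] := uc t e t0 e0.
    pose i := maxn N M.
    have [si ds] := hN i (leq_maxl _ _); have [ti dt] := hM i (leq_maxr _ _).
    have [_ _ _ gd] := geodesic_segmentP (geoP (u i)).
    have st : mdist (geo (u i) s) (geo (u i) t) = `|s - t|.
      by apply: gd; rewrite ?s0 ?t0.
    have := mdist_triangle (c s) (geo (u i) s) (c t).
    have := mdist_triangle (geo (u i) s) (geo (u i) t) (c t).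
    have := mdist_triangle (geo (u i) s) (c s) (geo (u i) t).
    have := mdist_triangle (c s) (c t) (geo (u i) t).
    rewrite st (mdistC (c s) (geo (u i) s)) (mdistC (c t) (geo _ t)) => h1 h2 h3 h4.
    by rewrite ler_norml; clear -h1 h2 h3 h4 ds dt; lra.
  apply/eqP; rewrite -subr_eq0 -normr_eq0 eq_le normr_ge0 andbT.
  apply/ler_addgt0Pr => e e0; rewrite add0r.
  have e2 : 0 < e / 2 by rewrite divr_gt0.
  by have := close _ e2; rewrite mulrC divfK// pnatr_eq0.
- apply: mdist_positivity; apply: le_anti; rewrite mdist_ge0 andbT.
  apply/ler_addgt0Pr => e e0; rewrite add0r.
  have [N hN] := uc 0 e (lexx 0) e0; have [_ +] := hN N (leqnn N).
  by have [-> _ _] := geoP (u N); rewrite mdistC.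
Qed.

(* A far enough point of the limit ray of [u] is separated from [o] by a long
   chain.  Since geodesics do not backtrack, a ray from [o] that is close to it
   there can only tend to a boundary point close to that of [u]. *)
Lemma tends_to_ray_sepchain u c k : cofinal L o u u -> tends_to_ray u c ->
  exists2 T, 0 <= T & forall v c', tends_to_ray v c' ->
    mdist (c T) (c' T) < 2^-1 ->
    exists N, forall i, (N <= i)%N -> sepchain k [set o] [set u i; v i].
Proof.
(* Comparing [u i], [a], [b], [v i] in turn costs at most [L + 5] to get past the chain, 1 for the
   step from [a] to [b], [L + 3] for backtracking and [L + 1] for each of two uses of
   hyperbolicity. *)
move=> uu uc; pose K := (k + 4 * L + 12)%N; have [i0 ui0] := uu K.
pose T := mdist o (u i0) + L.+1%:R.
have T0 : 0 <= T by rewrite addr_ge0 ?mdist_ge0.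
(* Two errors of 1/4 and the distance 1/2 of the rays add up to the 1 allowed by [sepchain_near]. *)
exists T => // v c' vc' cc'; have e0 : (0 : R) < 4^-1 by rewrite invr_gt0.
have [N uN] := uc T _ T0 e0; have [M vM] := vc' T _ T0 e0.
exists (maxn i0 (maxn N M)) => i; rewrite !geq_max => /and3P[ii Ni Mi].
have [Tu du] := uN i Ni; have [Tv dv] := vM i Mi.
pose a := geo (u i) T; pose b := geo (v i) T.
have ab : mdist a b <= 1.
  have := mdist_triangle a (c T) b; have := mdist_triangle (c T) (c' T) b.
  rewrite (mdistC (c' T) b); rewrite -/a in du; rewrite -/b in dv; clear -du dv cc'; lra.
have ha : sepchain (K - L - 5) [set o] [set a].
  have := sepchain_past X_CAT0 (geoP (u i)) (lexx T) (ui0 i0 i (leqnn _) ii).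
  by rewrite (min_l Tu).
have end_ w : geo w (mdist o w) = w by have [_ -> _] := geoP w.
have hau : sepchain (k + 2 * L + 2) [set o] [set a; u i].
  have := sepchain_no_backtrack X_CAT0 (geoP (u i)) T0 Tu (lexx _) ha.
  by rewrite end_ => /sepchainW; apply=> //; rewrite /K; clear; lia.
have hab : sepchain (k + 2 * L + 2) [set o] [set a; b].
  have : sepchain (K - L - 6).+1 [set o] [set a].
    by apply: (sepchainW ha) => //; rewrite /K; clear; lia.
  move=> /(sepchain_near X_CAT0)/(_ ab)/sepchainW; apply=> //.
  by rewrite /K; clear; lia.
have hb : sepchain (K - L - 6) [set o] [set b].
  have : sepchain (K - L - 6).+1 [set o] [set a].
    by apply: (sepchainW ha) => //; rewrite /K; clear; lia.
  by move=> /(sepchain_near X_CAT0)/(_ ab)/sepchainW; apply.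
have hbv : sepchain (k + L + 1) [set o] [set b; v i].
  have := sepchain_no_backtrack X_CAT0 (geoP (v i)) T0 Tv (lexx _) hb.
  by rewrite end_ => /sepchainW; apply=> //; rewrite /K; clear; lia.
have hub : sepchain (k + L + 1) [set o] [set u i; b].
  rewrite setUC in hau; have := sepchain_hyperbolic X_CAT0 hau hab.
  by move=> /sepchainW; apply=> //; clear; lia.
have := sepchain_hyperbolic X_CAT0 hub hbv.
by move=> /sepchainW; apply=> //; clear; lia.
Qed.

End LimitRay.

(** Kept general in [P] and [E] to serve for sequences and for rays alike. *)
Lemma push_class (R : realType) (X : metricType R) (D : Type)
    (g g' : X -> X) (P : set (D -> X)) (E : (D -> X) -> (D -> X) -> Prop) u :
  cancel g g' -> cancel g' g ->
  (forall v, P v -> P (g \o v)) -> (forall v, P v -> P (g' \o v)) ->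
  (forall v w, E v w -> E (g \o v) (g \o w)) ->
  (forall v w, E v w -> E (g' \o v) (g' \o w)) ->
  push g [set v | P v /\ E u v] = [set v | P v /\ E (g \o u) v].
Proof.
move=> gK g'K Pg Pg' Eg Eg'.
have gg' (v : D -> X) : g \o (g' \o v) = v by apply/funext => t /=; rewrite g'K.
have g'g (v : D -> X) : g' \o (g \o v) = v by apply/funext => t /=; rewrite gK.
apply/seteqP; split=> [_ [v [Pv Ev] <-]|v [Pv Ev]].
  by split; [exact: Pg|exact: Eg].
exists (g' \o v); last exact: gg'.
by split; [exact: Pg'|rewrite -(g'g u); exact: Eg'].
Qed.

(** * Injectivity, continuity, openness and equivariance of the boundary map *)

Section Main.
Context {R : realType} (X : metricType R) (X_complete : complete_space X)
  (X_CAT0 : CAT0 X) (L : nat) (o : X).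
Variable geo : X -> R -> X.
Hypothesis geoP : forall y, geodesic_segment o y (geo y).

Local Notation tends := (tends_to_ray o geo).

Lemma cofinal_isometry g u v : Defs.isometry g -> cofinal L o u v ->
  cofinal L o (g \o u) (g \o v).
Proof.
move=> gi uv k; pose D := dL L o (g o) + 2.
(* Passing from chains to products and back costs [L + 3] each way, and moving the basepoint costs
   [D]. *)
have [N hN] := uv (Num.bound `|D| + k + (L + 3) + (L + 3))%N.
exists N => i j Ni Nj; apply: (sepchain_of_gromov_product X_CAT0).
have := sepchain_gromov_product X_CAT0 (hN i j Ni Nj).
have := gromov_product_isometry X_CAT0 L o (u i) (v j) gi; rewrite -/D /=.
have : D <= (Num.bound `|D|)%:R.
  by rewrite (le_trans (ler_norm _))// ltW// archi_boundP.
rewrite !natrD; lra.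
Qed.

Lemma asymptotic_isometry g (c e : R -> X) : Defs.isometry g ->
  asymptotic c e -> asymptotic (g \o c) (g \o e).
Proof. by move=> [_ gd] [K ce]; exists K => t /ce; rewrite /= gd. Qed.

Lemma boundary_map_exists : exists f : gromov_boundary L o -> visual_boundary o,
  exists c : gromov_boundary L o -> R -> X, forall xi,
    [/\ val (f xi) (c xi), ray (c xi), c xi 0 = o &
        forall u, val xi u -> tends u (c xi)].
Proof.
have ex (xi : gromov_boundary L o) : exists p : visual_boundary o * (R -> X),
    [/\ val p.1 p.2, ray p.2, p.2 0 = o & forall u : nat -> X, val xi u -> tends u p.2].
  have [u [uu xiu xiP]] := gromov_boundary_rep X_CAT0 xi.
  have [c [rc c0 uc]] := tends_to_ray_exists X_CAT0 geoP X_complete uu.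
  have [zeta zc] := visual_boundary_make o rc.
  exists (zeta, c); split=> // v /xiP uv.
  exact: (tends_to_ray_cofinal X_CAT0 geoP uv).
have [p pP] := choice ex.
by exists (fun xi => (p xi).1), (fun xi => (p xi).2).
Qed.

Variables (f : gromov_boundary L o -> visual_boundary o)
  (c : gromov_boundary L o -> R -> X).
Hypothesis fP : forall xi, [/\ val (f xi) (c xi), ray (c xi), c xi 0 = o &
  forall u, val xi u -> tends u (c xi)].

Lemma boundary_map_injective : injective f.
Proof.
move=> xi eta fxe.
have [zc rc c0 cT] := fP xi; have [zc' rc' c'0 c'T] := fP eta.
have [u [uu xiu xiP]] := gromov_boundary_rep X_CAT0 xi.
have [v [vv etav etaP]] := gromov_boundary_rep X_CAT0 eta.
apply: (gromov_boundary_eq X_CAT0 xiu etav); apply: (equiv_cofinal X_CAT0) => //.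
apply/(gromov_equivP X_CAT0) => k.
have [T T0 hT] := tends_to_ray_sepchain X_CAT0 geoP k uu (cT _ xiu).
apply: (hT v (c eta)); first exact: c'T.
rewrite -fxe in zc'.
by rewrite (visual_boundary_from_o X_CAT0 zc c0 zc' c'0 T0) mdistxx invr_gt0.
Qed.

Lemma boundary_map_continuous : continuous f.
Proof.
apply/continuousP => A oA.
have {}oA : cone_open A by exact: oA.
suff : gromov_open (f @^-1` A) by [].
move=> xi /= /oA[r [e [e0 rA]]].
pose t := Num.max r 0.
have t0 : 0 <= t by rewrite le_max lexx orbT.
have e4 : 0 < e / 4 by rewrite divr_gt0.
have [k hk] := sepchain_fellow_uniform X_CAT0 L geoP t0 e4.
(* A product above this bound yields a chain of size [k]; the geodesics then differ by at most
   [e / 4], and so does each from its limit ray. *)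
exists (k%:R + (L + 3)%:R) => eta /= /boundary_product_gt[u [v [N [xiu etav uvN]]]].
apply: rA.
have [zc rc c0 cT] := fP xi; have [zc' rc' c'0 c'T] := fP eta.
exists (c xi), (c eta); split=> // s /andP[s0 sr].
have st : 0 <= s <= t by rewrite s0 le_max sr.
have [N1 h1] := cT u xiu s _ s0 e4; have [N2 h2] := c'T v etav s _ s0 e4.
pose i := maxn N (maxn N1 N2).
have [_ d1] : s <= mdist o (u i) /\ mdist (geo (u i) s) (c xi s) <= e / 4.
  by apply: h1; rewrite /i; lia.
have [_ d2] : s <= mdist o (v i) /\ mdist (geo (v i) s) (c eta s) <= e / 4.
  by apply: h2; rewrite /i; lia.
have [_ _ d3] := hk _ _ (sepchain_of_gromov_product X_CAT0 (ltW (uvN i (leq_maxl _ _)))).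
have {}d3 := d3 s st.
have := mdist_triangle (c xi s) (geo (u i) s) (c eta s).
have := mdist_triangle (geo (u i) s) (geo (v i) s) (c eta s).
rewrite (mdistC (c xi s) (geo _ _)); clear -d1 d2 d3 e0; lra.
Qed.

Lemma boundary_map_open (U : set (gromov_boundary L o)) : open U ->
  exists2 V, open V & f @` U = V `&` range f.
Proof.
move=> oU; have {}oU : gromov_open U by exact: oU.
(* The union of all cone neighbourhoods, centred at images of points of [U], whose trace on the
   range comes from [U]; it remains to find one around each [f xi]. *)
exists [set zeta | exists xi r e, [/\ U xi, 0 <= r, cone_nbhd (f xi) r e zeta &
    forall eta, cone_nbhd (f xi) r e (f eta) -> U eta]].
  suff h : forall W, cone_open W -> @open (visual_boundary o) W.
    apply: h => zeta [xi [r [e [Uxi r0 rz rU]]]].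
    have [s [d [d0 sd]]] := cone_nbhd_open X_CAT0 r0 rz.
    by exists s, d; split=> // z /sd; exists xi, r, e.
  by [].
apply/seteqP; split; last first.
  move=> zeta [[xi [r [e [Uxi r0 rz rU]]]] [eta _ ez]].
  by exists eta => //; apply: rU; rewrite ez.
move=> _ [xi Uxi <-].
split; last by exists xi.
have [R0 hR0] := oU xi Uxi.
have [zc rc c0 cT] := fP xi.
have [u [uu xiu xiP]] := gromov_boundary_rep X_CAT0 xi.
pose k := (Num.bound `|R0| + (L + 3))%N.
have [T T0 hT] := tends_to_ray_sepchain X_CAT0 geoP k uu (cT _ xiu).
exists xi, T, 2^-1; split=> //.
  by apply/(cone_nbhdP X_CAT0 _ T0 zc c0 zc c0); rewrite mdistxx invr_gt0.
move=> eta; have [zc' rc' c'0 c'T] := fP eta.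
move=> /(cone_nbhdP X_CAT0 _ T0 zc c0 zc' c'0) cc'.
apply: hR0 => /=.
have [v [vv etav etaP]] := gromov_boundary_rep X_CAT0 eta.
have [N hN] := hT v _ (c'T _ etav) cc'.
apply: (@lt_le_trans _ _ (Num.bound `|R0|)%:R%:E).
  by rewrite lte_fin (le_lt_trans (ler_norm _))// archi_boundP.
apply: (boundary_product_ge xiu etav (N := N)) => i Ni.
by have := sepchain_gromov_product X_CAT0 (hN i Ni); rewrite /k (natrD _ _ (L + 3)) addrK.
Qed.

Lemma boundary_map_equivariant : isom_equivariant f.
Proof.
move=> g gi xi; have [g' [g'i gK g'K]] := isometry_inverse gi.
have [u [uu xiu xiP]] := gromov_boundary_rep X_CAT0 xi.
have gu := cofinal_isometry gi uu.
have [eta etagu etaP] := gromov_boundary_make X_CAT0 gu.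
have [zc rc c0 cT] := fP xi; have [zc' rc' c'0 c'T] := fP eta.
exists eta.
  (* Cofinality with [u] already forces convergence, so [push_class] is used with [P := setT]. *)
  have -> : val xi = [set v | setT v /\ cofinal L o u v].
    by apply/seteqP; split=> [v /xiP|v [_ /xiP]].
  rewrite (push_class _ gK g'K)//.
  - by apply/seteqP; split=> [v /etaP|v [_ /etaP]].
  - by move=> v w; exact: cofinal_isometry.
  - by move=> v w; exact: cofinal_isometry.
rewrite (visual_boundaryE zc') (visual_boundaryE zc) (push_class _ gK g'K); first last.
- by move=> v w; exact: asymptotic_isometry.
- by move=> v w; exact: asymptotic_isometry.
- by move=> v; exact: geodesic_on_isometry.
- by move=> v; exact: geodesic_on_isometry.
have ce : asymptotic (c eta) (g \o c xi).
  (* The geodesics to [g y] from [o] and from [g o] differ by at most [2 * mdist o (g o)]; each is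
     within 1 of its limit ray. *)
  exists (2 * mdist o (g o) + 2) => t t0 /=.
  have [N1 h1] := cT u xiu t 1 t0 ltr01; have [N2 h2] := c'T _ etagu t 1 t0 ltr01.
  have [tu d1] := h1 (maxn N1 N2) (leq_maxl _ _).
  have [tgu d2] := h2 (maxn N1 N2) (leq_maxr _ _).
  move: tgu d2; rewrite /=; move: (u (maxn N1 N2)) tu d1 => y tu d1 tgu d2.
  have gs : geodesic_segment (g o) (g y) (g \o geo y).
    have [y0 yl yg] := geoP y; split; rewrite /= ?gi.2 ?y0 ?yl//.
    exact: geodesic_on_isometry.
  have := geodesic_fellow_common_end X_CAT0 (geoP (g y)) gs t0.
  rewrite gi.2 => /(_ tgu tu) d3.
  have := mdist_triangle (c eta t) (geo (g y) t) (g (c xi t)).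
  have := mdist_triangle (geo (g y) t) (g (geo y t)) (g (c xi t)).
  rewrite gi.2 (mdistC (c eta t) (geo _ _)); move: d1 d2 d3 => /=; lra.
apply/seteqP; split=> v [rv h]; split=> //.
  by apply: asymptotic_trans h; exact: asymptoticC.
exact: asymptotic_trans h.
Qed.

End Main.

Theorem theorem1p3 (R : realType) (X : metricType R)
    (X_complete : complete_space X) (X_CAT0 : CAT0 X) (L : nat) (o : X) :
  exists f : gromov_boundary L o -> visual_boundary o,
    isom_equivariant f /\ homeomorphic_embedding f.
Proof.
have [geo geoP] := choice (X_CAT0.1 o).
have [f [c fP]] := boundary_map_exists X_complete X_CAT0 L geoP.
exists f; split; first exact: (boundary_map_equivariant X_CAT0 geoP fP).
split.
- exact: (boundary_map_injective X_CAT0 geoP fP).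
- exact: (boundary_map_continuous X_CAT0 geoP fP).
- exact: (boundary_map_open X_CAT0 geoP fP).
Qed.
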